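(* Let $G$ and $H$ be Polish groups. There are a Polish group $T$ and embeddings $\psi_G:G\hookrightarrow T$, $\psi_H:H\hookrightarrow T$ such that the subgroup $\langle\psi_G(G),\psi_H(H)\rangle$ of $T$ is naturally isomorphic to the abstract free product $G*H$. Moreover, if $G$ and $H$ admit compatible left invariant ultrametrics, then $T$ (with embeddings $\psi_G:G\hookrightarrow T$, $\psi_H:H\hookrightarrow T$ such that $\langle\psi_G(G),\psi_H(H)\rangle$ is naturally isomorphic to $G*H$) can be chosen to also admit a compatible left invariant ultrametric.
   Context: A Polish group is a topological group whose topology is separable and completely metrizable. A metric on a topological group is compatible if it induces the group's topology, and left invariant if $d(fg_1,fg_2)=d(g_1,g_2)$ for all $f,g_1,g_2$. An ultrametric is a metric with $d(x,y)\le\max\{d(x,z),d(z,y)\}$. An embedding of topological groups is an injective homomorphism that is a homeomorphism onto its image. $G*H$ is the free product of $G$ and $H$ as abstract groups; ''naturally isomorphic'' means that the homomorphism $G*H\to T$ extending $\psi_G$ and $\psi_H$ is injective (hence an isomorphism onto $\langle\psi_G(G),\psi_H(H)\rangle$). *)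

(* Defs.v *)
From HB Require Import structures.
From mathcomp Require Import all_boot all_order all_algebra.
From mathcomp Require Import generic_quotient.
From mathcomp Require Import all_classical all_reals all_analysis.

Set Implicit Arguments.
Unset Strict Implicit.
Unset Printing Implicit Defensive.

Import Order.TTheory GRing.Theory Num.Theory.
Local Open Scope classical_set_scope.
Local Open Scope ring_scope.
Local Open Scope quotient_scope.

Section FreeProduct.
Local Open Scope group_scope.
Variables G H : groupType.

Definition fp_word := seq (G + H).

(* The monoid congruence on words generated by the multiplication tables
   of [G] and [H] and by the identification of their unit letters with the
   empty word. *)
Inductive fp_cong : fp_word -> fp_word -> Prop :=
| fp_cong_refl u : fp_cong u u
| fp_cong_sym u v : fp_cong u v -> fp_cong v u
| fp_cong_trans u v w : fp_cong u v -> fp_cong v w -> fp_cong u w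
| fp_cong_cat u u' v v' :
    fp_cong u u' -> fp_cong v v' -> fp_cong (u ++ v) (u' ++ v')
| fp_cong_1l : fp_cong [:: inl 1] [::]
| fp_cong_1r : fp_cong [:: inr 1] [::]
| fp_cong_Ml (x y : G) : fp_cong [:: inl x; inl y] [:: inl (x * y)]
| fp_cong_Mr (x y : H) : fp_cong [:: inr x; inr y] [:: inr (x * y)].

Definition fp_congb (u v : fp_word) : bool := `[< fp_cong u v >].

Lemma fp_congb_refl : reflexive fp_congb.
Proof. by move=> u; apply/asboolP; exact: fp_cong_refl. Qed.

Lemma fp_congb_sym : symmetric fp_congb.
Proof. by move=> u v; apply/asboolP/asboolP => /fp_cong_sym. Qed.

Lemma fp_congb_trans : transitive fp_congb.
Proof.
by move=> v u w /asboolP uv /asboolP vw; apply/asboolP; exact: fp_cong_trans vw.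
Qed.

Canonical fp_equiv := EquivRel fp_congb fp_congb_refl fp_congb_sym fp_congb_trans.

Definition freeprod := {eq_quot fp_equiv}.
HB.instance Definition _ := Choice.on freeprod.

Definition fp_pi (u : fp_word) : freeprod := (\pi_{eq_quot fp_equiv} u)%qT.
Definition fp_repr (a : freeprod) : fp_word := repr (a : {eq_quot fp_equiv}).

Lemma fp_reprK : cancel fp_repr fp_pi.
Proof. exact: reprK. Qed.

Lemma fp_piP u v : fp_pi u = fp_pi v <-> fp_cong u v.
Proof.
split=> [/eqP|uv]; first by rewrite /fp_pi eqmodE => /asboolP.
by apply/eqP; rewrite /fp_pi eqmodE; apply/asboolP.
Qed.

Lemma fp_repr_pi u : fp_cong (fp_repr (fp_pi u)) u.
Proof. by apply/fp_piP; rewrite fp_reprK. Qed.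

Definition fp_inv_letter (a : G + H) : G + H :=
  match a with inl x => inl x^-1 | inr y => inr y^-1 end.

Definition fp_inv_word (u : fp_word) : fp_word := rev (map fp_inv_letter u).

Lemma fp_cong_inv u v : fp_cong u v -> fp_cong (fp_inv_word u) (fp_inv_word v).
Proof.
rewrite /fp_inv_word; elim=> {u v} [u|u v _|u v w _ uv _|u u' v v' _ IHu _ IHv
  |||x y|x y].
- exact: fp_cong_refl.
- exact: fp_cong_sym.
- exact: fp_cong_trans.
- by rewrite !map_cat !rev_cat; exact: fp_cong_cat.
- by rewrite /= /rev/= invg1; exact: fp_cong_1l.
- by rewrite /= /rev/= invg1; exact: fp_cong_1r.
- by rewrite /= /rev/= invgM; exact: fp_cong_Ml.
- by rewrite /= /rev/= invgM; exact: fp_cong_Mr.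
Qed.

Lemma fp_cong_letterV (a : G + H) : fp_cong [:: fp_inv_letter a; a] [::].
Proof.
case: a => x /=.
- by apply: fp_cong_trans (fp_cong_Ml _ _) _; rewrite mulVg; exact: fp_cong_1l.
- by apply: fp_cong_trans (fp_cong_Mr _ _) _; rewrite mulVg; exact: fp_cong_1r.
Qed.

Lemma fp_cong_wordV u : fp_cong (fp_inv_word u ++ u) [::].
Proof.
rewrite /fp_inv_word; elim: u => [|a u IH] /=; first exact: fp_cong_refl.
rewrite rev_cons cat_rcons; apply: fp_cong_trans IH.
apply: fp_cong_cat; first exact: fp_cong_refl.
apply: (@fp_cong_cat [:: fp_inv_letter a; a] [::] u u).
  exact: fp_cong_letterV.
exact: fp_cong_refl.
Qed.

Lemma fp_inv_wordK u : fp_inv_word (fp_inv_word u) = u.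
Proof.
rewrite /fp_inv_word map_rev revK -map_comp -[RHS]map_id.
by apply: eq_map => -[x|x] /=; rewrite invgK.
Qed.

Definition fp_one : freeprod := fp_pi [::].
Definition fp_mul (a b : freeprod) : freeprod := fp_pi (fp_repr a ++ fp_repr b).
Definition fp_inv (a : freeprod) : freeprod := fp_pi (fp_inv_word (fp_repr a)).

Lemma fp_pi_cat u v : fp_pi (u ++ v) = fp_mul (fp_pi u) (fp_pi v).
Proof.
apply/fp_piP/fp_cong_sym; apply: fp_cong_cat; exact: fp_repr_pi.
Qed.

Lemma fp_mulA : associative fp_mul.
Proof.
move=> a b c; rewrite -[a]fp_reprK -[b]fp_reprK -[c]fp_reprK.
by rewrite -!fp_pi_cat catA.
Qed.

Lemma fp_mul1 : left_id fp_one fp_mul.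
Proof. by move=> a; rewrite -[a]fp_reprK -fp_pi_cat. Qed.

Lemma fp_mulr1 : right_id fp_one fp_mul.
Proof. by move=> a; rewrite -[a]fp_reprK -fp_pi_cat cats0. Qed.

Lemma fp_mulV : left_inverse fp_one fp_inv fp_mul.
Proof.
move=> a; rewrite -[X in fp_mul _ X]fp_reprK -fp_pi_cat.
by apply/fp_piP; exact: fp_cong_wordV.
Qed.

Lemma fp_mulrV : right_inverse fp_one fp_inv fp_mul.
Proof.
move=> a; rewrite -[X in fp_mul X _]fp_reprK -fp_pi_cat.
by apply/fp_piP; rewrite -{1}[fp_repr a]fp_inv_wordK; exact: fp_cong_wordV.
Qed.

HB.instance Definition _ :=
  isGroup.Build freeprod fp_mulA fp_mul1 fp_mulr1 fp_mulV fp_mulrV.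

Definition fp_inl (x : G) : freeprod := fp_pi [:: inl x].
Definition fp_inr (y : H) : freeprod := fp_pi [:: inr y].

Lemma fp_inlM : {morph fp_inl : x y / x * y}.
Proof.
move=> x y; rewrite /fp_inl -[RHS]fp_pi_cat.
by apply/fp_piP/fp_cong_sym; exact: fp_cong_Ml.
Qed.

Lemma fp_inl1 : fp_inl 1 = 1.
Proof. by apply/fp_piP; exact: fp_cong_1l. Qed.

Lemma fp_inrM : {morph fp_inr : x y / x * y}.
Proof.
move=> x y; rewrite /fp_inr -[RHS]fp_pi_cat.
by apply/fp_piP/fp_cong_sym; exact: fp_cong_Mr.
Qed.

Lemma fp_inr1 : fp_inr 1 = 1.
Proof. by apply/fp_piP; exact: fp_cong_1r. Qed.

HB.instance Definition _ := isMultiplicative.Build G freeprod fp_inl fp_inlM.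
HB.instance Definition _ :=
  Multiplicative_isUMagmaMorphism.Build G freeprod fp_inl fp_inl1.
HB.instance Definition _ := isMultiplicative.Build H freeprod fp_inr fp_inrM.
HB.instance Definition _ :=
  Multiplicative_isUMagmaMorphism.Build H freeprod fp_inr fp_inr1.

End FreeProduct.

(* The homomorphism out of the free product extending [f] and [g]; its
    universal property is [fp_lift_inl], [fp_lift_inr] and [fp_lift_unique]. *)

Section FreeProductLift.
Local Open Scope group_scope.
Variables (G H K : groupType).
Variables (f : UMagmaMorphism.type G K).
Variables (g : UMagmaMorphism.type H K).

Definition fp_eval_letter (a : G + H) : K :=
  match a with inl x => f x | inr y => g y end.

Definition fp_eval (u : fp_word G H) : K := \prod_(a <- u) fp_eval_letter a.

Lemma fp_eval_cong u v : fp_cong u v -> fp_eval u = fp_eval v.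
Proof.
rewrite /fp_eval.
elim=> {u v} [||u v w _ -> _ ->|u u' v v' _ IHu _ IHv|||x y|x y] //.
- by rewrite !big_cat IHu IHv.
- by rewrite big_seq1 big_nil /= gmulf1.
- by rewrite big_seq1 big_nil /= gmulf1.
- by rewrite !big_cons big_nil /= !mulg1 gmulfM.
- by rewrite !big_cons big_nil /= !mulg1 gmulfM.
Qed.

Definition fp_lift (a : freeprod G H) : K := fp_eval (fp_repr a).

Lemma fp_lift_pi u : fp_lift (fp_pi u) = fp_eval u.
Proof. by apply: fp_eval_cong; exact: fp_repr_pi. Qed.

Lemma fp_liftM : {morph fp_lift : a b / a * b}.
Proof. by move=> a b; rewrite [LHS]fp_lift_pi /fp_eval big_cat. Qed.

Lemma fp_lift1 : fp_lift 1 = 1.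
Proof. by rewrite [LHS]fp_lift_pi /fp_eval big_nil. Qed.

HB.instance Definition _ :=
  isMultiplicative.Build (freeprod G H) K fp_lift fp_liftM.
HB.instance Definition _ :=
  Multiplicative_isUMagmaMorphism.Build (freeprod G H) K fp_lift fp_lift1.

Lemma fp_lift_inl x : fp_lift (fp_inl H x) = f x.
Proof. by rewrite fp_lift_pi /fp_eval big_seq1. Qed.

Lemma fp_lift_inr y : fp_lift (fp_inr G y) = g y.
Proof. by rewrite fp_lift_pi /fp_eval big_seq1. Qed.

Lemma fp_lift_unique (h : UMagmaMorphism.type (freeprod G H) K) :
  (forall x, h (fp_inl H x) = f x) -> (forall y, h (fp_inr G y) = g y) ->
  h =1 fp_lift.
Proof.
move=> hf hg a; rewrite -[a]fp_reprK fp_lift_pi /fp_eval.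
elim: (fp_repr a) => [|b u IH].
  by rewrite big_nil; exact: gmulf1.
rewrite big_cons -IH -cat1s fp_pi_cat [LHS]gmulfM; congr (_ * _).
by case: b => x; [exact: hf|exact: hg].
Qed.

End FreeProductLift.

HB.structure Definition PreTopologicalGroup :=
  {G of Topological G & Group G}.

HB.mixin Record PreTopologicalGroup_isTopologicalGroup G
    & PreTopologicalGroup G := {
  mulg_continuous : continuous (fun x : G * G => (x.1 * x.2)%g) ;
  invg_continuous : continuous (fun x : G => (x^-1)%g)
}.

#[short(type="topologicalGroupType")]
HB.structure Definition TopologicalGroup :=
  {G of PreTopologicalGroup G & PreTopologicalGroup_isTopologicalGroup G}.

(* The inverse of [f] is only constrained on the range of [f], where it has
   to be continuous for the subspace topology. *)
Definition topgroup_embedding (G T : topologicalGroupType)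
    (f : UMagmaMorphism.type G T) : Prop :=
  [/\ injective f, continuous f &
      exists2 g : T -> G, cancel f g & {within range f, continuous g}].

Definition is_metric (R : realType) (X : Type) (d : X -> X -> R) : Prop :=
  [/\ forall x y, 0 <= d x y,
      forall x y, d x y = 0 <-> x = y,
      forall x y, d x y = d y x &
      forall x y z, d x y <= d x z + d z y].

Definition is_ultrametric (R : realType) (X : Type) (d : X -> X -> R) : Prop :=
  is_metric d /\ forall x y z, d x y <= Num.max (d x z) (d z y).

Definition compatible_metric (R : realType) (X : topologicalType)
    (d : X -> X -> R) : Prop :=
  forall (x : X) (A : set X),
    nbhs x A <-> exists2 e : R, 0 < e & [set y | d x y < e] `<=` A.

(* Cauchy sequences converge in the topology of [X]; this is completeness of
   [d] when [d] is a compatible metric. *)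
Definition complete_metric (R : realType) (X : topologicalType)
    (d : X -> X -> R) : Prop :=
  forall u : nat -> X,
    (forall e : R, 0 < e -> exists N : nat, forall m n : nat,
       (N <= m)%N -> (N <= n)%N -> d (u m) (u n) < e) ->
    exists l : X, u @ \oo --> l.

Definition left_invariant_metric (R : realType) (G : groupType)
    (d : G -> G -> R) : Prop :=
  forall f g1 g2 : G, d (f * g1)%g (f * g2)%g = d g1 g2.

Definition separable_space (X : topologicalType) : Prop :=
  exists2 D : set X, countable D & dense D.

Definition completely_metrizable (R : realType) (X : topologicalType) : Prop :=
  exists d : X -> X -> R,
    [/\ is_metric d, compatible_metric d & complete_metric d].

Definition polish_group (R : realType) (G : topologicalGroupType) : Prop :=
  separable_space G /\ completely_metrizable R G.

Definition left_inv_ultrametrizable (R : realType) (G : topologicalGroupType)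
    : Prop :=
  exists d : G -> G -> R,
    [/\ is_ultrametric d, compatible_metric d & left_invariant_metric d].

(* Main.v *)
Require Import Defs.
From HB Require Import structures.
From mathcomp Require Import all_boot all_order all_algebra.
From mathcomp Require Import all_classical all_reals all_analysis.
From mathcomp Require Import lra ring.

Set Implicit Arguments.
Unset Strict Implicit.
Unset Printing Implicit Defensive.

Import Order.TTheory GRing.Theory Num.Theory numFieldNormedType.Exports.
Local Open Scope classical_set_scope.
Local Open Scope ring_scope.

(** The idea is to embed the free product in a semidirect product. Let
    [K] be the direct product of [G] and [H], and let [K] act by translation
    on a group [N] containing an element [f] whose translates [f_p], for [p]
    in [K], satisfy no relation [f_(p_1) f_(p_2)^-1 f_(p_3) ... = 1] with
    consecutive points [p_i] distinct. In the semidirect product of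
    [K] and [N], send [g] in [G] to itself and [h] in [H] to its conjugate by
    [f]. Each letter [h] of a reduced word, preceded by a prefix with
    product [p] in [K], then contributes [f_p f_(ph)^-1] to the
    [N]-component of the image, so that this component is
    [f_(p_1) f_(p_2)^-1 f_(p_3) f_(p_4)^-1 ...] with consecutive points
    [p_i] distinct because the letters are nontrivial ([trace_path]). Hence
    it is not the unit, unless no letter of [H] occurs, in which case the word
    is a single letter of [G] and its [K]-component is not trivial
    ([lift_semidirect_injective]). The projections to [G] and to [H] are
    continuous on the whole semidirect product and invert the two maps, so
    these are embeddings.

    It remains to find a completely metrizable [N] on which [K] acts
    continuously. It consists of invertible functions with values in the
    2 x 2 real matrices, on a space of pairs [(u, s)] where [u : K -> [0, 1]]
    is Lipschitz for a left invariant metric and [s] is in [[0, 1]]; the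
    value of the translate [f_p] at [(u, s)] is the transvection
    [x -> x + s omega(x, v) v] of row vectors, with [v = (- u p, 1)] and
    [omega] the determinant form; its inverse is obtained by changing a sign.
    A product of such matrices is a polynomial in [s], whose degree is
    governed by the determinants [u p_(i+1) - u p_i]; if these are nonzero the
    polynomial is not constant, so some [s] gives a product different from 1
    ([transvection_prod_neq1]). A single function [u] separates the finitely
    many pairs of consecutive points, as a generic convex combination of
    functions that separate one pair each ([separate_path]). The sup norm
    makes these functions a complete ring; invertible elements are
    encoded as pairs of mutually inverse elements, and continuity of the action
    at each element is part of the definition of the group, since it defines
    a closed subgroup ([controlled_closed]).

    The left invariant metric on [K] comes from the metrization of its left
    uniformity ([left_invariant_metrization]). Finally the closed subgroup
    generated by the images of the separable groups [G] and [H] is separable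
    ([free_product_closure]).

    In the ultrametric case the same construction is run with the discrete
    norm on matrices and with functions [u] that are constant on the balls of
    a fixed radius [w]; the supremum is weighted by [w]. The norm on functions
    then satisfies the ultrametric inequality and multiplication by any
    element is a contraction, which makes the metric of the semidirect product
    a left invariant ultrametric. The record [coefficient_norm] and the
    predicate [lipschitz_test] state what the two cases have in common. *)

(** * Metric groups and the topological groups they define *)

Section MetricNotions.
Context {R : realType}.

Definition mcontinuous (X Y : Type) (dX : X -> X -> R) (dY : Y -> Y -> R)
    (f : X -> Y) : Prop :=
  forall x (e : R), 0 < e ->
    exists2 c : R, 0 < c & forall x', dX x x' < c -> dY (f x) (f x') < e.

Definition mcomplete (X : Type) (d : X -> X -> R) : Prop :=
  forall u : nat -> X,
    (forall e : R, 0 < e -> exists N : nat, forall m n : nat,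
       (N <= m)%N -> (N <= n)%N -> d (u m) (u n) < e) ->
    exists l : X, forall e : R, 0 < e ->
      exists N : nat, forall n, (N <= n)%N -> d l (u n) < e.

(** The dense set is given by an enumeration, which makes it easy to build
    dense sets of words from dense sets of letters. *)
Definition mseparable (X : Type) (d : X -> X -> R) : Prop :=
  exists (I : countType) (s : I -> X),
    forall x (e : R), 0 < e -> exists i, d x (s i) < e.

(** Groups are handled through a metric for which the operations are
    continuous; the metric need not be invariant, and so may be complete. *)
Definition metric_group (G : groupType) (d : G -> G -> R) : Prop :=
  [/\ is_metric d,
      forall x y (e : R), 0 < e -> exists2 c : R, 0 < c &
        forall x' y', d x x' < c -> d y y' < c -> d (x * y)%g (x' * y')%g < e &
      mcontinuous d d (fun x : G => x^-1%g)].

Lemma metric_refl (X : Type) (d : X -> X -> R) x : is_metric d -> d x x = 0.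
Proof. by case=> _ /(_ x x)[_ ->]. Qed.

End MetricNotions.

Section MetrizedGroup.
Context {R : realType} (G : groupType) (d : G -> G -> R).

(** An alias of the group whose topology is that of the metric; the proof
    argument lets the instances below be found from the type alone. *)
Definition metrized_group (h : metric_group d) : Type := G.

Hypothesis h : metric_group d.
Local Notation T := (metrized_group h).

HB.instance Definition _ := Group.copy T G.

Definition metrized_nbhs (x : T) : set_system T :=
  [set A | exists2 e : R, 0 < e & [set y | d x y < e] `<=` A].

HB.instance Definition _ := hasNbhs.Build T metrized_nbhs.

Let dm : is_metric d. Proof. by case: h. Qed.

Lemma metrized_nbhs_filter (x : T) : ProperFilter (nbhs x).
Proof.
split.
  by move=> [e e0 /(_ x)]; apply; rewrite /= metric_refl.
split.
- by exists 1.
- move=> A B [e e0 eA] [f f0 fB]; exists (Num.min e f);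
  first by rewrite lt_min e0.
  by move=> y /=; rewrite lt_min => /andP[ye yf]; split; [exact: eA|exact: fB].
- by move=> A B AB [e e0 eA]; exists e => //; exact: subset_trans AB.
Qed.

Lemma metrized_nbhs_singleton (x : T) (A : set T) : nbhs x A -> A x.
Proof. by move=> [e e0]; apply; rewrite /= metric_refl. Qed.

Lemma metrized_nbhs_nbhs (x : T) (A : set T) : nbhs x A -> nbhs x (nbhs^~ A).
Proof.
move=> [e e0 eA]; exists (e / 2); first by rewrite divr_gt0.
move=> y /= xy; exists (e / 2); first by rewrite divr_gt0.
move=> z /= yz; apply: eA => /=; case: dm => _ _ _ /(_ x z y); lra.
Qed.

HB.instance Definition _ := Nbhs_isNbhsTopological.Build T
  metrized_nbhs_filter metrized_nbhs_singleton metrized_nbhs_nbhs.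

Lemma metrized_mul_continuous : continuous (fun x : T * T => (x.1 * x.2)%g).
Proof.
move=> p A pA; have [e e0 eA] : metrized_nbhs (p.1 * p.2)%g A by exact: pA.
have [_ /(_ p.1 p.2 e e0)[c c0 cM] _] := h.
exists ([set x | d p.1 x < c], [set y | d p.2 y < c]) => /=.
  by split; exists c.
by move=> [x y] [/= px py]; apply: eA; exact: cM.
Qed.

Lemma metrized_inv_continuous : continuous (fun x : T => x^-1%g).
Proof.
move=> x A xA; have [e e0 eA] : metrized_nbhs (x^-1)%g A by exact: xA.
have [_ _ /(_ x e e0)[c c0 cV]] := h.
by exists c => // y /= xy; apply: eA; exact: cV.
Qed.

HB.instance Definition _ := PreTopologicalGroup_isTopologicalGroup.Build T
  metrized_mul_continuous metrized_inv_continuous.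

Lemma metrized_polish : mcomplete d -> mseparable d -> polish_group R T.
Proof.
move=> dc [I [s ds]]; split.
  exists (range s).
    exact: card_le_trans (card_image_le _ _) (countableP _).
  move=> U [x Ux] oU.
  have [e e0 eU] : nbhs x U by exact: open_nbhs_nbhs.
  by have [i /eU Ui] := ds x e e0; exists (s i); split=> //; exists i.
exists d; split => // u /dc[l ul]; exists l => A [e e0 eA].
by have [N lN] := ul e e0; exists N => // n /= /lN /eA.
Qed.

Lemma metrized_left_inv_ultrametrizable (d' : G -> G -> R) :
  mcontinuous d d' id -> mcontinuous d' d id ->
  is_ultrametric d' -> left_invariant_metric d' -> left_inv_ultrametrizable R T.
Proof.
move=> dd' d'd du dl; exists d'; split=> // x A; split=> -[e e0 eA].
  by have [c c0 cd] := d'd x e e0; exists c => // y /cd /eA.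
by have [c c0 cd] := dd' x e e0; exists c => // y /cd /eA.
Qed.

End MetrizedGroup.

Section TopologicalToMetric.
Context {R : realType} (G : topologicalGroupType) (d : G -> G -> R).
Hypotheses (dm : is_metric d) (dc : compatible_metric d).

Lemma nbhs_metric_ball x (e : R) : 0 < e -> nbhs x [set y | d x y < e].
Proof. by move=> e0; apply/dc; exists e. Qed.

Lemma compatible_metric_group : metric_group d.
Proof.
split=> // [x y e e0|x e e0].
  have := @mulg_continuous G (x, y) _ (nbhs_metric_ball (x * y)%g e0).
  move=> [[A B] /= [/dc[a a0 aA] /dc[b b0 bB]] AB].
  exists (Num.min a b); first by rewrite lt_min a0.
  move=> x' y'; rewrite !lt_min => /andP[xx' _] /andP[_ yy'].
  by apply: (AB (x', y')); split; [exact: aA|exact: bB].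
have /dc[c c0 cV] := @invg_continuous G x _ (nbhs_metric_ball (x^-1)%g e0).
by exists c.
Qed.

Lemma compatible_complete : complete_metric d -> mcomplete d.
Proof.
move=> dC u /dC[l ul]; exists l => e e0.
by have [N _ lN] := ul _ (nbhs_metric_ball l e0); exists N => n /lN.
Qed.

Lemma compatible_separable : separable_space G -> mseparable d.
Proof.
move=> [D Dc dD].
have close x (e : R) : 0 < e -> exists2 y, D y & d x y < e.
  move=> e0; have [||y []] := dD ([set y | d x y < e]°).
  - by exists x; exact: nbhs_metric_ball.
  - exact: open_interior.
  - by move=> /interior_subset xy Dy; exists y.
have [D0|/unsquash f] := pfcard_geP Dc.
  by have [y] := close 1%g _ ltr01; rewrite D0.
exists nat, f => x e /(close x)[y Dy xy].
by have [n _ fn] := @surj _ _ _ _ f _ Dy; exists n; rewrite fn.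
Qed.

Lemma mcontinuous_continuous (T : groupType) (D : T -> T -> R)
    (hD : metric_group D) (f : G -> metrized_group hD) :
  mcontinuous d D f -> continuous f.
Proof.
move=> fc x A [e e0 eA]; have [c c0 cf] := fc x e e0.
by apply/dc; exists c => // y /= /cf; exact: eA.
Qed.

Lemma continuous_from_metrized (T : groupType) (D : T -> T -> R)
    (hD : metric_group D) (g : metrized_group hD -> G) :
  mcontinuous D d g -> continuous g.
Proof.
move=> gc x A /dc[e e0 eA]; have [c c0 cg] := gc x e e0.
by exists c => // y /= /cg; exact: eA.
Qed.

End TopologicalToMetric.

(** * The closed subgroup generated by the image of a homomorphism *)

Section ClosureOfImage.
Context {R : realType} (Gam B : groupType) (D : B -> B -> R).
Hypothesis hD : metric_group D.
Variable phi : UMagmaMorphism.type Gam B.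

Definition image_closure : set B :=
  [set x | forall e : R, 0 < e -> exists2 c, range phi c & D x c < e].

Definition in_image_closure : {pred B} := fun x => `[< image_closure x >].

Let Dm : is_metric D. Proof. by case: hD. Qed.

Lemma image_closure_phi c : phi c \in in_image_closure.
Proof. by apply/asboolP => e e0; exists (phi c) => //; rewrite metric_refl. Qed.

Lemma image_closure_group : group_closed in_image_closure.
Proof.
have phi1 : phi 1%g = 1%g by exact: gmulf1.
split; first by rewrite -phi1; exact: image_closure_phi.
move=> x y /asboolP xS /asboolP yS; apply/asboolP => e e0.
case: hD => _ DM DV; have [c c0 cM] := DM x (y^-1)%g e e0.
have [b b0 bV] := DV y c c0.
have [_ [g _ <-] xg] := xS c c0; have [_ [k _ <-] yk] := yS b b0.
exists (phi (g * k^-1)%g); first by exists (g * k^-1)%g.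
by rewrite gmulfM gmulfV; apply: cM => //; exact: bV.
Qed.

Definition closure_group : Type := {x : B | x \in in_image_closure}.

HB.instance Definition _ := SubChoice.on closure_group.
HB.instance Definition _ :=
  SubChoice_isSubGroup.Build B in_image_closure closure_group
  image_closure_group.

Definition closure_metric (d : B -> B -> R) (x y : closure_group) : R :=
  d (val x) (val y).

Lemma closure_metric_group : metric_group (closure_metric D).
Proof.
case: hD => -[D0 Dxy Ds Dt] DM DV; split; first split.
- by move=> x y; exact: D0.
- move=> x y; rewrite /closure_metric; split=> [/Dxy/val_inj//|->].
  exact: metric_refl.
- by move=> x y; exact: Ds.
- by move=> x y z; exact: Dt.
- move=> x y e e0; have [c c0 cM] := DM (val x) (val y) e e0.
  by exists c => // x' y'; exact: cM.
- move=> x e e0; have [c c0 cV] := DV (val x) e e0.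
  by exists c => // y; exact: cV.
Qed.

Lemma closure_metric_complete : mcomplete D -> mcomplete (closure_metric D).
Proof.
move=> DC u uC; have [l ul] := DC (val \o u) uC.
have lS : l \in in_image_closure.
  apply/asboolP => e e0; have e2 : 0 < e / 2 by rewrite divr_gt0.
  have [N /(_ N (leqnn _)) lN] := ul _ e2.
  have /asboolP /(_ _ e2) [c cr Nc] := valP (u N).
  exists c => //; case: Dm => _ _ _ /(_ l c (val (u N))); move: lN Nc => /=;
    lra.
by exists (Sub l lS : closure_group).
Qed.

Lemma closure_ultrametric d : is_ultrametric d ->
  is_ultrametric (closure_metric d).
Proof.
move=> [[d0 dxy ds dt] du]; split=> [|x y z]; last exact: du.
split=> [x y|x y|x y|x y z]; [exact: d0| |exact: ds|exact: dt].
by rewrite /closure_metric; split=> [/dxy/val_inj|->] //; exact/dxy.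
Qed.

Lemma closure_separable (I : countType) (s : I -> Gam) :
  (forall g (e : R), 0 < e -> exists i, D (phi g) (phi (s i)) < e) ->
  mseparable (closure_metric D).
Proof.
move=> sd; pose j g : closure_group := Sub (phi g) (image_closure_phi g).
exists I, (j \o s) => x e e0.
have e2 : 0 < e / 2 by rewrite divr_gt0.
have /asboolP /(_ _ e2) [_ [g _ <-] xg] := valP x.
have [i gi] := sd g _ e2; exists i.
case: Dm => _ _ _ /(_ (val x) (phi (s i)) (phi g)).
by rewrite /closure_metric /=; lra.
Qed.

Section Corestriction.
Variables (G : groupType) (f : UMagmaMorphism.type G B).
Hypothesis fS : forall x, f x \in in_image_closure.

Definition corestr (x : G) : closure_group := Sub (f x) (fS x).

Lemma corestrM : {morph corestr : x y / (x * y)%g}.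
Proof. by move=> x y; apply: val_inj; rewrite /= gmulfM. Qed.

Lemma corestr1 : corestr 1%g = 1%g.
Proof. by apply: val_inj; rewrite /= gmulf1. Qed.

HB.instance Definition _ :=
  isMultiplicative.Build G closure_group corestr corestrM.
HB.instance Definition _ :=
  Multiplicative_isUMagmaMorphism.Build G closure_group corestr corestr1.

End Corestriction.

End ClosureOfImage.

Section FreeProductClosure.
Context {R : realType} (G H : topologicalGroupType).
Variables (dG : G -> G -> R) (dH : H -> H -> R).
Hypotheses (dGc : compatible_metric dG) (dHc : compatible_metric dH).
Hypotheses (sepG : mseparable dG) (sepH : mseparable dH).
Variables (B : groupType) (D : B -> B -> R).
Hypotheses (hD : metric_group D) (DC : mcomplete D).
Variables (psiG : UMagmaMorphism.type G B) (psiH : UMagmaMorphism.type H B).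
Hypotheses (psiGc : mcontinuous dG D psiG) (psiHc : mcontinuous dH D psiH).
Variables (rG : B -> G) (rH : B -> H).
Hypotheses (rGc : mcontinuous D dG rG) (rHc : mcontinuous D dH rH).
Hypotheses (psiGK : cancel psiG rG) (psiHK : cancel psiH rH).
Hypothesis lift_inj : injective (fp_lift psiG psiH).

Let phi : UMagmaMorphism.type (freeprod G H) B := fp_lift psiG psiH.

(** Words with letters in countable dense subsets of [G] and [H] approximate
    all words, by continuity of the multiplication. *)
Lemma free_product_image_separable :
  exists (I : countType) (s : I -> freeprod G H),
    forall g (e : R), 0 < e -> exists i, D (phi g) (phi (s i)) < e.
Proof.
have [I [s sP]] := sepG; have [J [t tP]] := sepH.
pose letter (a : I + J) : G + H :=
  match a with inl i => inl (s i) | inr j => inr (t j) end.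
exists (seq (I + J)), (fun w => fp_pi (map letter w)) => g e e0.
suff [v gv] : exists v, D (fp_eval psiG psiH (fp_repr g))
                          (fp_eval psiG psiH (map letter v)) < e.
  by exists v; rewrite -[g]fp_reprK /phi /= !fp_lift_pi.
have [Dm DM _] := hD.
elim: (fp_repr g) e e0 => [|a w IH] e e0.
  by exists [::]; rewrite (metric_refl _ Dm).
have [c c0 cM] := DM (fp_eval_letter psiG psiH a) (fp_eval psiG psiH w) e e0.
have [v vw] := IH c c0.
have [b ab] : exists b, D (fp_eval_letter psiG psiH a)
                          (fp_eval_letter psiG psiH (letter b)) < c.
  case: a {cM} => x /=.
    have [k k0 kx] := psiGc x c0; have [i xi] := sP x k k0.
    by exists (inl i); exact: kx.
  have [k k0 kx] := psiHc x c0; have [i xi] := tP x k k0.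
  by exists (inr i); exact: kx.
by exists (b :: v); rewrite /fp_eval /= !big_cons; exact: cM.
Qed.

(** Any completely metrized group in which [G] and [H] generate a free product
    can be replaced by a separable one. The continuous retractions of the
    ambient group restrict to the closed subgroup, so that the homomorphisms
    remain embeddings. *)
Lemma free_product_closure :
  exists (T : topologicalGroupType)
      (jG : UMagmaMorphism.type G T) (jH : UMagmaMorphism.type H T),
    [/\ polish_group R T, topgroup_embedding jG, topgroup_embedding jH &
        injective (fp_lift jG jH)] /\
    (forall d : B -> B -> R, mcontinuous D d id -> mcontinuous d D id ->
     is_ultrametric d -> left_invariant_metric d ->
       left_inv_ultrametrizable R T).
Proof.
have inG x : psiG x \in in_image_closure D phi.
  by rewrite -(fp_lift_inl psiG psiH); exact: (image_closure_phi hD phi).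
have inH x : psiH x \in in_image_closure D phi.
  by rewrite -(fp_lift_inr psiG psiH); exact: (image_closure_phi hD phi).
have hC := closure_metric_group hD phi.
have [I [s sP]] := free_product_image_separable.
pose jG : UMagmaMorphism.type G (metrized_group hC) := corestr inG.
pose jH : UMagmaMorphism.type H (metrized_group hC) := corestr inH.
exists (metrized_group hC), jG, jH; split; last first.
  move=> d Dd dD du dl.
  apply: (@metrized_left_inv_ultrametrizable _ _ _ hC (closure_metric d)).
  - by move=> x e /(Dd (val x))[c c0 cD]; exists c => // y; exact: cD.
  - by move=> x e /(dD (val x))[c c0 cD]; exists c => // y; exact: cD.
  - exact: closure_ultrametric.
  - by move=> f x y; exact: dl.
split.
- apply: metrized_polish; first exact: closure_metric_complete.
  exact: closure_separable sP.
- split.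
  + by move=> x y /(congr1 val)/= /(can_inj psiGK).
  + exact: (mcontinuous_continuous dGc).
  + exists (rG \o val) => [x|]; first exact: psiGK.
    apply: continuous_subspaceT; apply: (continuous_from_metrized dGc).
    by move=> x e e0; have [c c0 cr] :=
      rGc (val x) e0; exists c => // y; exact: cr.
- split.
  + by move=> x y /(congr1 val)/= /(can_inj psiHK).
  + exact: (mcontinuous_continuous dHc).
  + exists (rH \o val) => [x|]; first exact: psiHK.
    apply: continuous_subspaceT; apply: (continuous_from_metrized dHc).
    by move=> x e e0; have [c c0 cr] :=
      rHc (val x) e0; exists c => // y; exact: cr.
- have valE g : val (fp_lift jG jH g) = fp_lift psiG psiH g.
    rewrite -[g]fp_reprK !fp_lift_pi /fp_eval.
    elim: (fp_repr g) => [|a w IH]; first by rewrite !big_nil.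
    by rewrite !big_cons -IH; case: a.
  by move=> x y xy; apply: lift_inj; rewrite -!valE xy.
Qed.
End FreeProductClosure.

(** * Semidirect products with the units of a normed ring *)

Section RingNorm.
Context {R : realType} (B : pzRingType) (N : B -> R).

(** The last condition replaces submultiplicativity: it also holds for norms
    truncated at 1, and it is what makes the elements with a bounded
    multiplication operator a closed set. *)
Definition ring_norm : Prop :=
  [/\ forall x, 0 <= N x, forall x, N x = 0 <-> x = 0,
      forall x, N (- x) = N x, forall x y, N (x + y) <= N x + N y &
      forall x e, N e < 1 -> N (x * e) <= N x /\ N (e * x) <= N x].

Definition norm_dist (x y : B) : R := N (x - y).

Hypothesis hN : ring_norm.

Lemma ring_norm0 : N 0 = 0. Proof. by case: hN => _ N0 _ _ _; exact/N0. Qed.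

Lemma norm_dist_metric : is_metric norm_dist.
Proof.
case: hN => Nge N0 NN ND _; split=> [x y|x y|x y|x y z].
- exact: Nge.
- rewrite /norm_dist; split=> [/N0/subr0_eq//|->]; rewrite subrr;
  exact: ring_norm0.
- by rewrite /norm_dist -NN opprB.
- by rewrite /norm_dist; have := ND (x - z) (z - y); rewrite addrA subrK.
Qed.
End RingNorm.

Section SemidirectProduct.
Context {R : realType}.
Variables (K : groupType) (dK : K -> K -> R).
Hypothesis hK : metric_group dK.
Variables (B : pzRingType) (N : B -> R).
Hypotheses (hN : ring_norm N).
Variable act : K -> B -> B.

Definition isometric_action : Prop :=
  [/\ forall x, act 1%g x = x, forall k l x, act (k * l)%g x = act k (act l x),
      forall k, {morph act k : x y / x - y},
      forall k, {morph act k : x y / x * y} &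
      forall k x, N (act k x) = N x].
Hypothesis hA : isometric_action.

Definition multiplier (b : B) : Prop :=
  exists2 C : R, 0 < C & forall x, N (x * b) <= C * N x /\ N (b * x) <= C * N x.

(** Neither is multiplication by an arbitrary element bounded, nor is the
    orbit map of an arbitrary element continuous; the group below is made of
    the elements for which both hold. *)
Definition controlled (b : B) : Prop :=
  multiplier b /\ mcontinuous dK (norm_dist N) (act^~ b).

Let Nm : is_metric (norm_dist N). Proof. exact: norm_dist_metric. Qed.

Let Km : is_metric dK. Proof. by case: hK. Qed.

Lemma actVK k x : act k (act k^-1%g x) = x.
Proof. by have [a1 aM _ _ _] := hA; rewrite -aM mulgV a1. Qed.

Lemma act_one k : act k 1 = 1.
Proof.
have [_ _ _ aM _] := hA.
by have := aM k 1 (act k^-1%g 1); rewrite mul1r actVK mulr1.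
Qed.

Lemma controlled1 : controlled 1.
Proof.
split; first by exists 1 => // x; rewrite mulr1 !mul1r.
by move=> k e e0; exists 1 => // k' _; rewrite !act_one (metric_refl _ Nm).
Qed.

Lemma multiplier_act k b : multiplier b -> multiplier (act k b).
Proof.
move=> [C C0 Cb]; exists C => // x.
have [_ _ _ aM aN] := hA.
by rewrite -(actVK k x); move: (act _ x) => y; rewrite -!aM !aN; exact: Cb.
Qed.

Lemma controlled_act k b : controlled b -> controlled (act k b).
Proof.
move=> [bm bc]; split; first exact: multiplier_act.
move=> l e e0; have [c c0 cb] := bc (l * k)%g e e0.
have [_ KM _] := hK; have [c' c'0 cM] := KM l k c c0.
exists c' => // l' ll'; have [_ aM _ _ _] := hA.
by rewrite -!aM; apply: cb; apply: cM => //; rewrite (metric_refl _ Km).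
Qed.

Lemma mul_close x y (e : R) : multiplier x -> multiplier y -> 0 < e ->
  exists2 c : R, 0 < c & forall x' y',
    norm_dist N x x' < c -> norm_dist N y y' < c ->
    norm_dist N (x * y) (x' * y') < e.
Proof.
move=> [C C0 Cx] [C' C'0 Cy] e0.
have S0 : 0 < C + C' + 1 by rewrite !addr_gt0.
exists (Num.min 1 (e / (C + C' + 1))); first by rewrite lt_min ltr01 divr_gt0.
move=> x' y'; rewrite !lt_min !ltr_pdivlMr // /norm_dist.
move=> /andP[_ xx'] /andP[yy1 yy'].
have [Nge _ NN ND NM] := hN.
have -> : x * y - x' * y' =
    x * (y - y') + ((x - x') * y + - ((x - x') * (y - y'))).
  by rewrite -mulrBr subKr mulrBr mulrBl addrA subrK.
apply: le_lt_trans (ND _ _) _; have :=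
  ND ((x - x') * y) (- ((x - x') * (y - y'))).
have := NM (x - x') _ yy1; have := Cx (y - y'); have := Cy (x - x'); rewrite NN.
have := Nge (x - x'); have := Nge (y - y').
move: xx' yy'; set p := N (x - x'); set q := N (y - y').
move=> pS qS q0 p0 [Cp _] [_ Cq] [pq _] Npq.
have : C * q + C' * p + p < e; last by lra.
have [pq'|qp] := leP p q.
  apply: le_lt_trans qS; nra.
apply: le_lt_trans pS; nra.
Qed.

Lemma multiplierM x y : multiplier x -> multiplier y -> multiplier (x * y).
Proof.
move=> [C C0 Cx] [C' C'0 Cy]; exists (C * C'); first exact: mulr_gt0.
move=> z; split.
  rewrite mulrA; apply: le_trans (proj1 (Cy _)) _.
  by rewrite [C * C']mulrC -mulrA ler_pM2l //; exact: (proj1 (Cx _)).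
rewrite -mulrA; apply: le_trans (proj2 (Cx _)) _.
by rewrite -mulrA ler_pM2l //; exact: (proj2 (Cy _)).
Qed.

Lemma act_close k a (e : R) : controlled a -> 0 < e ->
  exists2 c : R, 0 < c & forall k' a',
    dK k k' < c -> norm_dist N a a' < c ->
      norm_dist N (act k a) (act k' a') < e.
Proof.
move=> [_ ac] e0; have e2 : 0 < e / 2 by rewrite divr_gt0.
have [c c0 cb] := ac k _ e2.
exists (Num.min c (e / 2)); first by rewrite lt_min c0.
move=> k' a'; rewrite !lt_min => /andP[/cb kk' _] /andP[_ aa'].
case: Nm => _ _ _ /(_ (act k a) (act k' a') (act k' a)).
have [_ _ aB _ aN] := hA.
by rewrite {3}/norm_dist -aB aN; move: kk' aa'; rewrite /norm_dist; lra.
Qed.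

Lemma controlledM x y : controlled x -> controlled y -> controlled (x * y).
Proof.
move=> xc yc; split; first by apply: multiplierM; [case: xc|case: yc].
move=> k e e0; have [_ _ _ aM _] := hA.
have [xk _] := controlled_act k xc; have [yk _] := controlled_act k yc.
have [c c0 cM] := mul_close xk yk e0.
have [_ /(_ k c c0)[a a0 ax]] := xc; have [_ /(_ k c c0)[b b0 yb]] := yc.
exists (Num.min a b); first by rewrite lt_min a0.
by move=> k'; rewrite lt_min !aM => /andP[/ax kx /yb ky]; exact: cM.
Qed.

Lemma controlledB x y : controlled x -> controlled y -> controlled (x - y).
Proof.
have [Nge _ NN ND _] := hN; have [_ _ aB _ aN] := hA.
move=> [[C C0 Cx] xc] [[C' C'0 Cy] yc]; split.
  exists (C + C'); first exact: addr_gt0.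
  move=> z; have [zx xz] := Cx z; have [zy yz] := Cy z.
  rewrite mulrBr mulrBl mulrDl; split; apply: le_trans (ND _ _) _; rewrite NN;
  exact: lerD.
move=> k e e0; have e2 : 0 < e / 2 by rewrite divr_gt0.
have [c c0 cx] := xc k _ e2; have [b b0 yb] := yc k _ e2.
exists (Num.min c b); first by rewrite lt_min c0.
move=> k'; rewrite lt_min => /andP[/cx kx /yb ky].
rewrite /norm_dist !aB.
have -> : act k x - act k y - (act k' x - act k' y) =
  (act k x - act k' x) - (act k y - act k' y).
  by rewrite !opprD !opprK addrACA.
apply: le_lt_trans (ND _ _) _; rewrite NN; move: kx ky; rewrite /norm_dist; lra.
Qed.

(** Near a controlled element [x], write [b = x + (b - x)]: multiplication by
    the small element [b - x] is a contraction, and as [K] acts by isometries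
    the orbit map of [b] is uniformly close to that of [x]. *)
Lemma controlled_closed b :
  (forall e : R, 0 < e -> exists2 x, controlled x & norm_dist N b x < e) ->
  controlled b.
Proof.
have [Nge _ NN ND NM] := hN; have [_ _ aB _ aN] := hA.
move=> bx; split.
  have [x [[C C0 Cx] _] bx1] := bx 1 ltr01.
  exists (C + 1); first by rewrite addr_gt0.
  move=> z; have [zx xz] := Cx z; have [zb bz] := NM z _ bx1.
  split.
    have := ND (z * x) (z * (b - x)); rewrite -mulrDr subrKC; lra.
  have := ND (x * z) ((b - x) * z); rewrite -mulrDl subrKC; lra.
move=> k e e0; have e3 : 0 < e / 3 by rewrite divr_gt0.
have [x [_ xc] bx3] := bx _ e3; have [c c0 cx] := xc k _ e3.
exists c => // k' /cx kk'.
have [_ _ Ns Nt] := Nm.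
have bxk l : norm_dist N (act l b) (act l x) < e / 3.
  by rewrite /norm_dist -aB aN.
have := Nt (act k b) (act k' b) (act k x).
have := Nt (act k x) (act k' b) (act k' x).
by have := bxk k; have := bxk k'; rewrite (Ns (act k' b)); lra.
Qed.
End SemidirectProduct.

Section SemidirectGroup.
Context {R : realType}.
Variables (K : groupType) (dK : K -> K -> R).
Variables (B : pzRingType) (N : B -> R) (act : K -> B -> B).

(** A unit is encoded with its inverse, so that inversion is an isometry and
    the units are closed in the product of two copies of the ring. *)
Definition unit_pair (t : K * (B * B)) : Prop :=
  [/\ t.2.1 * t.2.2 = 1, t.2.2 * t.2.1 = 1,
      controlled dK N act t.2.1 & controlled dK N act t.2.2].

Definition is_unit_pair : pred (K * (B * B)) := fun t => `[< unit_pair t >].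

Definition semidirect (hK : metric_group dK) (hN : ring_norm N)
  (hA : isometric_action N act) : Type := {t : K * (B * B) | is_unit_pair t}.

Hypotheses (hK : metric_group dK) (hN : ring_norm N)
  (hA : isometric_action N act).
Local Notation T := (semidirect hK hN hA).

HB.instance Definition _ := SubChoice.on T.

Definition sd_base (t : T) : K := (val t).1.
Definition sd_unit (t : T) : B := (val t).2.1.
Definition sd_inverse (t : T) : B := (val t).2.2.

Lemma sdP (t : T) : unit_pair (val t).
Proof. exact/asboolP/(valP t). Qed.

Lemma sd_eq (t u : T) : sd_base t = sd_base u -> sd_unit t = sd_unit u ->
  sd_inverse t = sd_inverse u -> t = u.
Proof.
rewrite /sd_base /sd_unit /sd_inverse => tu1 tu2 tu3; apply: val_inj.
by case: (val t) (val u) tu1 tu2 tu3 => [? [? ?]] [? [? ?]] /= -> -> ->.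
Qed.

Definition sd_one_raw : K * (B * B) := (1%g, (1, 1)).
Definition sd_mul_raw (t u : K * (B * B)) : K * (B * B) :=
  ((t.1 * u.1)%g, (t.2.1 * act t.1 u.2.1, act t.1 u.2.2 * t.2.2)).
Definition sd_inv_raw (t : K * (B * B)) : K * (B * B) :=
  (t.1^-1%g, (act t.1^-1%g t.2.2, act t.1^-1%g t.2.1)).

Lemma sd_one_subproof : is_unit_pair sd_one_raw.
Proof. by apply/asboolP; split; rewrite ?mulr1 //=; exact: controlled1. Qed.

Lemma sd_mul_subproof (t u : T) : is_unit_pair (sd_mul_raw (val t) (val u)).
Proof.
have [t1 t2 t3 t4] := sdP t; have [u1 u2 u3 u4] := sdP u.
have [_ _ _ aM _] := hA.
apply/asboolP; split => /=.
- by rewrite mulrA -[X in X * _]mulrA -aM u1 (act_one hA) mulr1.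
- by rewrite mulrA -[X in X * _]mulrA t2 mulr1 -aM u2 (act_one hA).
- by apply: (controlledM hK hN hA) => //; exact: (controlled_act hK hA).
- by apply: (controlledM hK hN hA) => //; exact: (controlled_act hK hA).
Qed.

Lemma sd_inv_subproof (t : T) : is_unit_pair (sd_inv_raw (val t)).
Proof.
have [t1 t2 t3 t4] := sdP t; have [_ _ _ aM _] := hA.
apply/asboolP; split => /=.
- by rewrite -aM t2 (act_one hA).
- by rewrite -aM t1 (act_one hA).
- exact: (controlled_act hK hA).
- exact: (controlled_act hK hA).
Qed.

Definition sd_one : T := Sub sd_one_raw sd_one_subproof.
Definition sd_mul (t u : T) : T :=
  Sub (sd_mul_raw (val t) (val u)) (sd_mul_subproof t u).
Definition sd_inv (t : T) : T := Sub (sd_inv_raw (val t)) (sd_inv_subproof t).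

Lemma sd_mulA : associative sd_mul.
Proof.
have [_ am _ aM _] := hA.
move=> t u v; apply: sd_eq; rewrite /sd_base /sd_unit /sd_inverse /=.
- exact: mulgA.
- by rewrite aM am mulrA.
- by rewrite aM am mulrA.
Qed.

Lemma sd_mul1 : left_id sd_one sd_mul.
Proof.
have [a1 _ _ _ _] := hA.
move=> t; apply: sd_eq; rewrite /sd_base /sd_unit /sd_inverse /=.
- exact: mul1g.
- by rewrite mul1r a1.
- by rewrite mulr1 a1.
Qed.

Lemma sd_mulr1 : right_id sd_one sd_mul.
Proof.
move=> t; apply: sd_eq; rewrite /sd_base /sd_unit /sd_inverse /=.
- exact: mulg1.
- by rewrite (act_one hA) mulr1.
- by rewrite (act_one hA) mul1r.
Qed.

Lemma sd_mulV : left_inverse sd_one sd_inv sd_mul.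
Proof.
have [_ _ _ aM _] := hA.
move=> t; have [t1 t2 _ _] := sdP t.
apply: sd_eq; rewrite /sd_base /sd_unit /sd_inverse /=.
- exact: mulVg.
- by rewrite -aM t2 (act_one hA).
- by rewrite -aM t2 (act_one hA).
Qed.

Lemma sd_mulrV : right_inverse sd_one sd_inv sd_mul.
Proof.
have [_ _ _ aM _] := hA.
move=> t; have [t1 t2 _ _] := sdP t.
apply: sd_eq; rewrite /sd_base /sd_unit /sd_inverse /=.
- exact: mulgV.
- by rewrite (actVK hA).
- by rewrite (actVK hA).
Qed.

HB.instance Definition _ :=
  isGroup.Build T sd_mulA sd_mul1 sd_mulr1 sd_mulV sd_mulrV.

(** The metric on [K] is a parameter of its own: completeness and left
    invariance will be obtained for two different metrics. *)
Definition sd_dist (d : K -> K -> R) (t u : T) : R :=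
  Num.max (d (sd_base t) (sd_base u))
    (Num.max (norm_dist N (sd_unit t) (sd_unit u))
             (norm_dist N (sd_inverse t) (sd_inverse u))).

Lemma sd_dist_lt (d : K -> K -> R) t u (e : R) : sd_dist d t u < e <->
  [/\ d (sd_base t) (sd_base u) < e,
      norm_dist N (sd_unit t) (sd_unit u) < e &
      norm_dist N (sd_inverse t) (sd_inverse u) < e].
Proof. by rewrite /sd_dist !gt_max; split=> [/and3P//|? ]; exact/and3P. Qed.

Let Nm : is_metric (norm_dist N). Proof. exact: norm_dist_metric. Qed.

Lemma sd_dist_metric d : is_metric d -> is_metric (sd_dist d).
Proof.
move=> [d0 dxy ds dt]; have [N0 Nxy Ns Nt] := Nm; split.
- by move=> t u; rewrite /sd_dist le_max d0.
- move=> t u; split=> [tu|->].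
    have h e : 0 < e -> sd_dist d t u < e by rewrite tu.
    have z (r : R) : 0 <= r -> (forall e, 0 < e -> r < e) -> r = 0.
      move=> r0 re; apply/eqP; rewrite eq_le r0 andbT leNgt; apply/negP.
      by move=> /re; rewrite ltxx.
    apply: sd_eq; [apply/dxy|apply/Nxy|apply/Nxy]; apply: z => // e /h;
    by move=> /sd_dist_lt[].
  by rewrite /sd_dist !(metric_refl _ (And4 d0 dxy ds dt), metric_refl _ Nm)
    !maxxx.
- by move=> t u; rewrite /sd_dist ds (Ns (sd_unit t)) (Ns (sd_inverse t)).
- move=> t u v; rewrite /sd_dist !ge_max; apply/and3P; split.
  + by apply: le_trans (dt _ _ (sd_base v)) _; rewrite lerD ?le_max ?lexx.
  + by apply: le_trans (Nt _ _ (sd_unit v)) _; rewrite lerD ?le_max ?lexx ?orbT.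
  + by apply: le_trans (Nt _ _ (sd_inverse v)) _;
    rewrite lerD ?le_max ?lexx ?orbT.
Qed.

Lemma sd_metric_group : metric_group (sd_dist dK).
Proof.
have [Km KM KV] := hK; split; first exact: sd_dist_metric.
- move=> t u e e0; have [t1 t2 t3 t4] := sdP t; have [u1 u2 u3 u4] := sdP u.
  have [c c0 cK] := KM (sd_base t) (sd_base u) e e0.
  have [m3 _] := t3; have [m4 _] := t4.
  have [n3 _] := controlled_act hK hA (sd_base t) u3.
  have [n4 _] := controlled_act hK hA (sd_base t) u4.
  have [a a0 aM] := mul_close hN m3 n3 e0.
  have [b b0 bM] := mul_close hN n4 m4 e0.
  have [a' a'0 aA] := act_close hN hA (sd_base t) u3 a0.
  have [b' b'0 bA] := act_close hN hA (sd_base t) u4 b0.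
  exists (Num.min c (Num.min (Num.min a b) (Num.min a' b'))).
    by rewrite !lt_min c0 a0 b0 a'0.
  move=> t' u' /sd_dist_lt[tt1 tt2 tt3] /sd_dist_lt[uu1 uu2 uu3].
  move: tt1 tt2 tt3 uu1 uu2 uu3; rewrite !lt_min.
  move=> /and3P[tc _ /andP[ta' tb']] /and3P[_ /andP[uta _] _].
  move=> /and3P[_ /andP[_ itb] _].
  move=> /and3P[uc _ _] /and3P[_ _ /andP[ua' _]] /and3P[_ _ /andP[_ ub']].
  apply/sd_dist_lt; split.
  + exact: cK.
  + by apply: aM => //; exact: aA.
  + by apply: bM => //; exact: bA.
- move=> t e e0; have [t1 t2 t3 t4] := sdP t.
  have [a a0 aA] := act_close hN hA (sd_base t)^-1%g t3 e0.
  have [b b0 bA] := act_close hN hA (sd_base t)^-1%g t4 e0.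
  have m0 : 0 < Num.min e (Num.min a b) by rewrite !lt_min e0 a0.
  have [c c0 cV] := KV (sd_base t) _ m0.
  exists (Num.min c (Num.min a b)); first by rewrite !lt_min c0 a0.
  move=> u /sd_dist_lt[]; rewrite !lt_min => /and3P[/cV tu _ _].
  move=> /and3P[_ ua _] /and3P[_ _ ub].
  move: tu; rewrite !lt_min => /and3P[te ta tb].
  by apply/sd_dist_lt; split=> //; [exact: bA|exact: aA].
Qed.

Lemma sd_complete : mcomplete dK -> mcomplete (norm_dist N) ->
  mcomplete (sd_dist dK).
Proof.
move=> KC NC u uC.
have [|k kl] := KC (sd_base \o u).
  by move=> e /uC[M uM]; exists M => m n mM nM; have /sd_dist_lt[] :=
    uM m n mM nM.
have [|a al] := NC (sd_unit \o u).
  by move=> e /uC[M uM]; exists M => m n mM nM; have /sd_dist_lt[] :=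
    uM m n mM nM.
have [|b bl] := NC (sd_inverse \o u).
  by move=> e /uC[M uM]; exists M => m n mM nM; have /sd_dist_lt[] :=
    uM m n mM nM.
have ac : controlled dK N act a.
  apply: (controlled_closed hN hA) => e /al[M /(_ M (leqnn _)) aM].
  by exists (sd_unit (u M)) => //; have [] := sdP (u M).
have bc : controlled dK N act b.
  apply: (controlled_closed hN hA) => e /bl[M /(_ M (leqnn _)) bM].
  by exists (sd_inverse (u M)) => //; have [] := sdP (u M).
(* The equations defining unit pairs pass to the limit. *)
have lim1 x y : multiplier N x -> multiplier N y ->
    (forall e : R, 0 < e -> exists x' y', [/\ norm_dist N x x' < e,
      norm_dist N y y' < e & x' * y' = 1]) -> x * y = 1.
  move=> xm ym xy; have [N0 Nxy _ _] := Nm; apply/Nxy/eqP.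
  rewrite eq_le N0 andbT leNgt; apply/negP => d0.
  have [c c0 cM] := mul_close hN xm ym d0.
  have [x' [y' [xx' yy' x'y']]] := xy c c0.
  by have := cM _ _ xx' yy'; rewrite x'y' ltxx.
have close (e : R) : 0 < e -> exists M, forall n, (M <= n)%N ->
    [/\ dK k (sd_base (u n)) < e, norm_dist N a (sd_unit (u n)) < e &
        norm_dist N b (sd_inverse (u n)) < e].
  move=> e0; have [M1 h1] := kl e e0; have [M2 h2] := al e e0.
  have [M3 h3] := bl e e0; exists (maxn M1 (maxn M2 M3)) => n.
  by rewrite !geq_max => /and3P[/h1 ? /h2 ? /h3 ?].
have lP : is_unit_pair (k, (a, b)).
  have [am _] := ac; have [bm _] := bc.
  apply/asboolP; split=> //=; apply: lim1 => // e /close[M /(_ M (leqnn _)) []].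
    move=> _ ae be; exists (sd_unit (u M)), (sd_inverse (u M)).
    by have [] := sdP (u M).
  move=> _ ae be; exists (sd_inverse (u M)), (sd_unit (u M)).
  by have [] := sdP (u M).
exists (Sub (k, (a, b)) lP : T) => e /close[M uM]; exists M => n /uM[? ? ?].
exact/sd_dist_lt.
Qed.

Lemma sd_ultrametric d :
  is_ultrametric d -> (forall x y, N (x + y) <= Num.max (N x) (N y)) ->
  is_ultrametric (sd_dist d).
Proof.
move=> [dm du] Nu; split=> [|t u v]; first exact: sd_dist_metric.
have Nd x y z : norm_dist N x y <= Num.max (norm_dist N x z) (norm_dist N z y).
  by rewrite /norm_dist; apply: le_trans (Nu _ _); rewrite addrA subrK.
rewrite /sd_dist !ge_max; apply/and3P; split.
- by apply: le_trans (du _ _ (sd_base v)) _; rewrite ge_max !le_max !lexx ?orbT.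
- by apply: le_trans (Nd _ _ (sd_unit v)) _; rewrite ge_max !le_max !lexx ?orbT.
- by apply: le_trans (Nd _ _ (sd_inverse v)) _;
  rewrite ge_max !le_max !lexx ?orbT.
Qed.

(** Left multiplication by [t] contracts distances; so does left
    multiplication by the inverse of [t], hence both are isometries. *)
Lemma sd_left_invariant d : left_invariant_metric d ->
  (forall x y, N (x * y) <= N x /\ N (x * y) <= N y) ->
  left_invariant_metric (sd_dist d).
Proof.
move=> dl Ns.
have shrink t u v : sd_dist d (t * u)%g (t * v)%g <= sd_dist d u v.
  have [_ _ aB _ aN] := hA.
  rewrite /sd_dist {1}/sd_base {1}/sd_base {1}/sd_unit {1}/sd_unit.
  rewrite {1}/sd_inverse {1}/sd_inverse /= /norm_dist -mulrBr -mulrBl -!aB.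
  rewrite !ge_max dl !le_max lexx /=.
  have [_ h1] := Ns (val t).2.1 (act (val t).1 (sd_unit u - sd_unit v)).
  have [h2 _] := Ns (act (val t).1 (sd_inverse u - sd_inverse v)) (val t).2.2.
  by move: h1 h2; rewrite !aN => -> ->; rewrite !orbT.
move=> t u v; apply/eqP; rewrite eq_le shrink /=.
by have := shrink t^-1%g (t * u)%g (t * v)%g; rewrite !mulKg.
Qed.

Lemma sd_dist_equiv d : mcontinuous dK d id -> mcontinuous d dK id ->
  mcontinuous (sd_dist dK) (sd_dist d) id /\
  mcontinuous (sd_dist d) (sd_dist dK) id.
Proof.
move=> Kd dKc; split=> t e e0.
  have [c c0 cd] := Kd (sd_base t) e e0.
  exists (Num.min c e); first by rewrite lt_min c0.
  move=> u /sd_dist_lt[];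
    rewrite !lt_min => /andP[/cd ? _] /andP[_ ?] /andP[_ ?].
  exact/sd_dist_lt.
have [c c0 cd] := dKc (sd_base t) e e0.
exists (Num.min c e); first by rewrite lt_min c0.
move=> u /sd_dist_lt[]; rewrite !lt_min => /andP[/cd ? _] /andP[_ ?] /andP[_ ?].
exact/sd_dist_lt.
Qed.

End SemidirectGroup.

(** * The free product inside a semidirect product *)

Section ReducedWords.
Variables G H : groupType.

Definition nontrivial_letter (a : G + H) : bool :=
  match a with inl x => x != 1%g | inr y => y != 1%g end.

Definition is_left (a : G + H) : bool := if a is inl _ then true else false.

Definition reduced (w : fp_word G H) : bool :=
  all nontrivial_letter w && sorted (fun a b => is_left a != is_left b) w.

Lemma fp_cong_cons a (v w : fp_word G H) :
  fp_cong v w -> fp_cong (a :: v) (a :: w).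
Proof. by move=> vw; apply: (@fp_cong_cat _ _ [:: a] [:: a]) => //;
  exact: fp_cong_refl. Qed.

Lemma fp_cong_trivial a (w : fp_word G H) :
  ~~ nontrivial_letter a -> fp_cong (a :: w) w.
Proof.
move=> a1; apply: (@fp_cong_cat _ _ [:: a] [::]); last exact: fp_cong_refl.
case: a a1 => x /=; rewrite negbK => /eqP ->; first exact: fp_cong_1l.
exact: fp_cong_1r.
Qed.

Definition letter_mul (a b : G + H) : G + H :=
  match a, b with
  | inl x, inl y => inl (x * y)%g
  | inr x, inr y => inr (x * y)%g
  | _, _ => a
  end.

Lemma fp_cong_letter_mul a b (w : fp_word G H) :
  is_left a = is_left b -> fp_cong [:: a, b & w] (letter_mul a b :: w).
Proof.
move=> ab; apply: (@fp_cong_cat _ _ [:: a; b] [:: letter_mul a b]);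
  last exact: fp_cong_refl.
by case: a b ab => x [] y //= _; [exact: fp_cong_Ml|exact: fp_cong_Mr].
Qed.

(** A letter put before a reduced word is dropped if trivial, and merged with
    the first letter if both lie in the same factor; if they cancel, the tail
    is still alternating. *)
Lemma reduced_word (w : fp_word G H) : exists2 v, reduced v & fp_cong w v.
Proof.
elim: w => [|a w [v vr wv]]; first by exists [::] => //; exact: fp_cong_refl.
have awv := fp_cong_cons a wv.
have [a1|a1] := boolP (nontrivial_letter a); last first.
  by exists v => //; apply: fp_cong_trans awv _; exact: fp_cong_trivial.
case: v vr awv {wv} => [|b v] vr awv.
  by exists [:: a]; rewrite /reduced /= ?a1.
have [ab|ab] := eqVneq (is_left a) (is_left b); last first.
  by exists [:: a, b & v] => //; move: vr; rewrite /reduced /= a1 ab.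
have abv : fp_cong (a :: w) (letter_mul a b :: v).
  by apply: fp_cong_trans awv _; exact: fp_cong_letter_mul.
have [/andP[/= vn vs] bv] : reduced v /\ reduced (b :: v).
  split=> //; move: vr; rewrite /reduced /= => /andP[/andP[_ ->]].
  exact: path_sorted.
have [c1|c1] := boolP (nontrivial_letter (letter_mul a b)); last first.
  exists v; first by rewrite /reduced vn vs.
  by apply: fp_cong_trans abv _; exact: fp_cong_trivial.
exists (letter_mul a b :: v) => //; rewrite /reduced /= c1 vn /=.
move: vr => /andP[_ /=].
case: v {vn vs bv awv abv} => //= c v /andP[bc ->]; rewrite andbT.
by have -> : is_left (letter_mul a b) = is_left b by case: (a) (b) ab => x [].
Qed.

End ReducedWords.

Lemma trivial_kernel_injective (A B : groupType) (f : UMagmaMorphism.type A B) :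
  (forall x, f x = 1%g -> x = 1%g) -> injective f.
Proof.
move=> f1 x y xy; have xy1 : (x * y^-1)%g = 1%g.
  by apply: f1; rewrite gmulfM gmulfV xy mulgV.
by rewrite -[x](mulgVK y) xy1 mul1g.
Qed.

Section FreeProductInSemidirect.
Context {R : realType}.
Variables (K : groupType) (dK : K -> K -> R).
Variables (B : pzRingType) (N : B -> R) (act : K -> B -> B).
Variables (hK : metric_group dK) (hN : ring_norm N)
  (hA : isometric_action N act).
Local Notation T := (semidirect hK hN hA).
Local Notation D := (@sd_dist R K dK B N act hK hN hA dK).

Lemma sd_incl_subproof k : is_unit_pair dK N act (k, (1, 1)).
Proof. by apply/asboolP; split; rewrite /= ?mulr1 //; exact: controlled1. Qed.

Definition sd_incl (k : K) : T := Sub (k, (1, 1)) (sd_incl_subproof k).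

Lemma sd_incl_continuous : mcontinuous dK D sd_incl.
Proof.
have Nm := norm_dist_metric hN.
move=> k e e0; exists e => // l kl; apply/sd_dist_lt.
by split; rewrite //= (metric_refl _ Nm).
Qed.

Section ConjugateInclusion.
Variables (f : T) (L : groupType) (j : UMagmaMorphism.type L K).

Definition conj_incl (x : L) : T := (f * sd_incl (j x) * f^-1)%g.

Lemma sd_inclM : {morph sd_incl : k l / (k * l)%g}.
Proof.
move=> k l; apply: sd_eq; rewrite /sd_unit /sd_inverse //=.
  by rewrite mul1r (act_one hA).
by rewrite mulr1 (act_one hA).
Qed.

Lemma sd_incl1 : sd_incl 1 = 1%g.
Proof. exact: val_inj. Qed.

Lemma conj_inclM : {morph conj_incl : x y / (x * y)%g}.
Proof.
by move=> x y; rewrite /conj_incl gmulfM sd_inclM !mulgA mulgVK.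
Qed.

Lemma conj_incl1 : conj_incl 1%g = 1%g.
Proof. by rewrite /conj_incl gmulf1 sd_incl1 mulg1 mulgV. Qed.

HB.instance Definition _ := isMultiplicative.Build L T conj_incl conj_inclM.
HB.instance Definition _ :=
  Multiplicative_isUMagmaMorphism.Build L T conj_incl conj_incl1.

Lemma conj_incl_continuous (dL : L -> L -> R) :
  mcontinuous dL dK j -> mcontinuous dL D conj_incl.
Proof.
have [Dm DM _] := sd_metric_group hK hN hA.
move=> jc x e e0.
have [c c0 cM] := DM (f * sd_incl (j x))%g (f^-1)%g e e0.
have [b b0 bM] := DM f (sd_incl (j x)) c c0.
have [a a0 aI] := sd_incl_continuous (j x) b0.
have [k k0 kj] := jc x a a0.
exists k => // y /kj/aI xy.
by apply: cM; [apply: bM|]; rewrite ?(metric_refl _ Dm).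
Qed.

Hypothesis f1 : sd_base f = 1%g.

Lemma conj_incl_base x : sd_base (conj_incl x) = j x.
Proof.
by rewrite /conj_incl /sd_base /= -/(sd_base f) f1 mul1g invg1 mulg1.
Qed.

Lemma conj_incl_unit x :
  sd_unit (conj_incl x) = sd_unit f * act (j x) (sd_inverse f).
Proof.
have [a1 aM _ _ _] := hA.
rewrite /conj_incl /sd_unit /= -/(sd_base f) f1 mul1g (act_one hA) mulr1.
by rewrite invg1 a1.
Qed.
End ConjugateInclusion.

Lemma sd_unitM (t u : T) : sd_unit (t * u)%g = sd_unit t * act (sd_base t)
  (sd_unit u).
Proof. by []. Qed.

Lemma sd_base_continuous : mcontinuous D dK (@sd_base R K dK B N act hK hN hA).
Proof. by move=> t e e0; exists e => // u /sd_dist_lt[]. Qed.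

Section FreeProduct.
Variables (G H : groupType).
Variables (iG : UMagmaMorphism.type G K) (iH : UMagmaMorphism.type H K).
Hypotheses (iG_inj : injective iG) (iH_inj : injective iH).
Variable f : T.
Hypothesis f1 : sd_base f = 1%g.

(** The boolean is true for a translate of the unit [f] and false for a
    translate of its inverse. *)
Definition translate (p : bool * K) : B :=
  act p.2 (if p.1 then sd_unit f else sd_inverse f).

Hypothesis translates_free : forall z (l : seq (bool * K)), l != [::] ->
  path (fun k l => k != l) z (map snd l) -> \prod_(p <- l) translate p != 1.

(** The signed points at which the translates of [f] occur in the unit
    component of the image of a word, [P] being the product in [K] of the
    letters already read. *)
Fixpoint trace (P : K) (w : fp_word G H) : seq (bool * K) :=
  match w with
  | [::] => [::]
  | inl g :: v => trace (P * iG g)%g v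
  | inr h :: v => [:: (true, P), (false, (P * iH h)%g) & trace (P * iH h)%g v]
  end.

Let psiG := conj_incl 1%g iG.
Let psiH := conj_incl f iH.

Lemma act_eval P w :
  act P (sd_unit (fp_eval psiG psiH w)) = \prod_(p <- trace P w) translate p.
Proof.
have [a1 aM _ am _] := hA.
elim: w P => [|a w IH] P; rewrite /fp_eval /=.
  by rewrite !big_nil (act_one hA).
rewrite big_cons sd_unitM am -aM IH.
case: a => x /=; rewrite conj_incl_unit ?conj_incl_base //.
  by rewrite !mul1r (act_one hA) (act_one hA) mul1r.
by rewrite !big_cons /translate /= mulrA am -aM.
Qed.

Let neq_mulr (P k : K) : (P != P * k)%g = (k != 1%g).
Proof. by rewrite eq_sym -[X in _ != X]mulg1 (inj_eq (mulgI P)). Qed.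

(** [z] stands for the last point recorded before the word [w]: it is the
    current prefix [P] after a letter of [H], and differs from [P] if a letter
    of [G] has been read since. *)
Definition compatible_start (z P : K) (w : fp_word G H) : Prop :=
  match w with inl _ :: _ => z = P | inr _ :: _ => z != P | [::] => True end.

(** A letter of [H] separates the two points it records, and a letter of [G]
    separates the points recorded by its neighbours. *)
Lemma trace_path w P z : reduced w -> compatible_start z P w ->
  path (fun k l => k != l) z (map snd (trace P w)).
Proof.
elim: w P z => //= -[x|y] w IH P z /andP[/= /andP[a1 wn] ws] zP.
  apply: IH; first by rewrite /reduced wn (path_sorted ws).
  case: w wn ws => //= -[//|y'] w _ _; rewrite zP.
  by rewrite neq_mulr (gmulf_eq1 _ iG_inj).
rewrite zP neq_mulr (gmulf_eq1 _ iH_inj) a1 /=.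
apply: IH; first by rewrite /reduced wn (path_sorted ws).
by case: w wn ws => //= -[].
Qed.

Lemma trace_nil w P : reduced w -> trace P w = [::] -> w = [::] \/
  exists2 g, g != 1%g & w = [:: inl g].
Proof.
case: w => [|[x|y] [|[x'|y'] w]] //=; first by left.
- by rewrite /reduced /= !andbT => x1 _; right; exists x.
- by rewrite /reduced /= andbF.
Qed.

(** The kernel is trivial: a reduced word with a letter in [H] has a
    nontrivial unit component, and one without is a single letter of [G]. *)
Lemma lift_semidirect_injective : injective (fp_lift psiG psiH).
Proof.
apply: trivial_kernel_injective => g; rewrite -[g]fp_reprK.
have [w wr gw] := reduced_word (fp_repr g).
rewrite (iffRL (fp_piP _ _) gw) /= fp_lift_pi => w1.
have [tr|tr] := eqVneq (trace 1%g w) [::].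
  case: (trace_nil wr tr) w1 => [->//|[x x1 ->]].
  rewrite /fp_eval big_seq1 /= => /(congr1 (@sd_base _ _ _ _ _ _ _ _ _)).
  rewrite conj_incl_base // => /= ix.
  by move: x1; rewrite -(gmulf_eq1 _ iG_inj) ix eqxx.
have [z zw] : exists z, compatible_start z 1%g w.
  case: w wr {gw w1 tr} => [|[x|y] w]; [by exists 1%g|by exists 1%g|].
  move=> /andP[/= /andP[y1 _] _]; exists (iH y).
  by rewrite (gmulf_eq1 _ iH_inj).
have /eqP[] := translates_free tr (trace_path wr zw).
by rewrite -act_eval w1 (act_one hA).
Qed.
End FreeProduct.
End FreeProductInSemidirect.

(** * Rings of matrix-valued functions *)

Section SupNorm.
Context {R : realType}.
Variables (Y : Type) (y0 : Y) (V : pzRingType) (nu : V -> R) (w : Y -> R).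
Hypotheses (nu_ge0 : forall a, 0 <= nu a)
  (nu_eq0 : forall a, nu a = 0 <-> a = 0)
  (nuN : forall a, nu (- a) = nu a)
    (nuD : forall a b, nu (a + b) <= nu a + nu b)
  (nuM : forall a b, nu (a * b) <= nu a * nu b).
Hypotheses (w_gt0 : forall y, 0 < w y)
  (w_nu : forall y a, w y * nu a < 1 -> nu a <= 1).

(** Truncation at 1 makes the supremum finite for every function, so that all
    functions form a complete normed ring. *)
Definition capped (y : Y) (a : V) : R := Num.min 1 (w y * nu a).

Definition sup_norm (n : Y -> V) : R := sup (range (fun y => capped y (n y))).

Lemma capped_ge0 y a : 0 <= capped y a.
Proof. by rewrite le_min ler01 mulr_ge0 // ltW. Qed.

Lemma sup_norm_ge y n : capped y (n y) <= sup_norm n.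
Proof.
apply: ub_le_sup; last by exists y.
by exists 1 => _ [z _ <-]; rewrite ge_min lexx.
Qed.

Lemma sup_norm_le n r : (forall y, capped y (n y) <= r) -> sup_norm n <= r.
Proof.
move=> nr; apply: ge_sup; first by exists (capped y0 (n y0)), y0.
by move=> _ [y _ <-].
Qed.

Lemma capped_lt y a e : e <= 1 -> capped y a < e -> w y * nu a < e.
Proof. by move=> e1; rewrite gt_min => /orP[/(le_lt_trans e1)|//];
  rewrite ltxx. Qed.

Lemma capped_scale y a b C : 1 <= C -> nu b <= C * nu a ->
  capped y b <= C * capped y a.
Proof.
move=> C1 ba; have C0 : 0 < C by apply: lt_le_trans C1.
rewrite /capped minr_pMr ?(ltW C0) // mulr1 le_min !ge_min C1 /=.
rewrite mulrCA; apply/orP; right; exact: (ler_wpM2l (ltW (w_gt0 y))).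
Qed.

Lemma sup_norm_scale n m C : 1 <= C ->
  (forall y, nu (n y) <= C * nu (m y)) -> sup_norm n <= C * sup_norm m.
Proof.
move=> C1 nm; apply: sup_norm_le => y;
  apply: le_trans (capped_scale y C1 (nm y)) _.
by rewrite ler_wpM2l ?sup_norm_ge // (le_trans ler01).
Qed.

Lemma sup_norm_mono n m :
  (forall y, nu (n y) <= nu (m y)) -> sup_norm n <= sup_norm m.
Proof.
by move=> nm; rewrite -[leRHS]mul1r; apply: sup_norm_scale => // y;
  rewrite mul1r.
Qed.

Lemma sup_norm_ring_norm : ring_norm sup_norm.
Proof.
have nu0 : nu 0 = 0 by exact/nu_eq0.
split.
- by move=> n; apply: le_trans (sup_norm_ge y0 n); exact: capped_ge0.
- move=> n; split=> [n0|->].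
    apply/funext => y; apply/nu_eq0; apply/eqP.
    have := sup_norm_ge y n; rewrite n0 ge_min ler10 /= pmulr_rle0 // => ny.
    by rewrite eq_le ny nu_ge0.
  apply/eqP; rewrite eq_le; apply/andP; split.
    by apply: sup_norm_le => y; rewrite /capped nu0 mulr0 ge_min lexx orbT.
  by apply: le_trans (sup_norm_ge y0 _); exact: capped_ge0.
- by move=> n; rewrite /sup_norm /capped; under eq_fun do rewrite nuN.
- move=> n m; apply: sup_norm_le => y.
  apply: le_trans (lerD (sup_norm_ge y n) (sup_norm_ge y m)).
  have := ler_wpM2l (ltW (w_gt0 y)) (nuD (n y) (m y));
    rewrite mulrDr /capped /=.
  have := mulr_ge0 (ltW (w_gt0 y)) (nu_ge0 (n y)).
  have := mulr_ge0 (ltW (w_gt0 y)) (nu_ge0 (m y)).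
  set a := w y * nu (n y); set b := w y * nu (m y).
  move=> b0 a0 ab; rewrite ge_min; apply/orP.
  have [a1|a1] := leP 1 a; first by left; rewrite lerDl le_min ler01.
  have [b1|b1] := leP 1 b; first by left; rewrite lerDr.
  by right.
- move=> n e e1.
  have e1' y : nu (e y) <= 1.
    by apply: (@w_nu y); apply: capped_lt => //; apply: le_lt_trans e1;
      exact: sup_norm_ge.
  split; apply: sup_norm_mono => y; apply: le_trans (nuM _ _) _.
    by rewrite ler_piMr.
  by rewrite ler_piMl.
Qed.

Lemma bounded_multiplier b C :
  1 <= C -> (forall y, nu (b y) <= C) -> multiplier sup_norm b.
Proof.
move=> C1 bC; exists C; first exact: lt_le_trans C1.
move=> x; split; apply: sup_norm_scale => // y; apply: le_trans (nuM _ _) _.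
  by rewrite mulrC ler_wpM2r.
by rewrite ler_wpM2r.
Qed.

Lemma sup_norm_complete :
  mcomplete (fun a b => nu (a - b)) -> mcomplete (norm_dist sup_norm).
Proof.
move=> VC n nC.
have unif (e : R) : 0 < e -> exists M, forall i j, (M <= i)%N -> (M <= j)%N ->
    forall y, w y * nu (n i y - n j y) < e.
  move=> e0; have m0 : 0 < Num.min e 1 by rewrite lt_min e0 ltr01.
  have [M nM] := nC _ m0; exists M => i j iM jM y.
  have : w y * nu (n i y - n j y) < Num.min e 1.
    apply: capped_lt; first by rewrite ge_min lexx orbT.
    exact: le_lt_trans (sup_norm_ge y (n i - n j)) (nM i j iM jM).
  by rewrite lt_min => /andP[].
have pt y : exists l, forall e : R, 0 < e ->
    exists M : nat, forall i, (M <= i)%N -> nu (l - n i y) < e.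
  apply: (VC (fun i => n i y)) => e e0.
  have [M nM] := unif _ (mulr_gt0 (w_gt0 y) e0); exists M => i j iM jM.
  by have := nM i j iM jM y; rewrite ltr_pM2l.
have [l lP] := choice pt; exists l => e e0.
have e2 : 0 < e / 2 by rewrite divr_gt0.
have [M nM] := unif _ e2; exists M => i iM.
apply: (@le_lt_trans _ _ (e / 2));
  last by rewrite ltr_pdivrMr // ltr_pMr // ltr1n.
apply: sup_norm_le => y; rewrite ge_min; apply/orP; right.
apply/ler_addgt0Pr => r r0.
have [M' lM'] := lP y (r / w y) (divr_gt0 r0 (w_gt0 y)).
pose j := maxn M M'.
have jl := lM' j (leq_maxr _ _); have ji := nM j i (leq_maxl _ _) iM y.
have wp := w_gt0 y.
have {}jl : w y * nu (l y - n j y) < r by rewrite mulrC -ltr_pdivlMr.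
have := ler_wpM2l (ltW wp) (nuD (l y - n j y) (n j y - n i y)).
rewrite addrA subrK mulrDr.
move: ji jl; rewrite [(l - n i) y]/=; lra.
Qed.

Section Translation.
Variables (K : groupType) (r : K -> Y -> Y).
Hypotheses (r1 : forall y, r 1%g y = y)
  (rM : forall k l y, r (k * l)%g y = r l (r k y))
    (wr : forall k y, w (r k y) = w y).

Definition precompose (k : K) (n : Y -> V) : Y -> V := n \o r k.

Lemma precompose_isometric : isometric_action sup_norm precompose.
Proof.
have le k n : sup_norm (precompose k n) <= sup_norm n.
  apply: sup_norm_le => y; apply: le_trans (sup_norm_ge (r k y) n).
  by rewrite /capped wr.
have p1 n : precompose 1%g n = n by apply/funext => y;
  rewrite /precompose /= r1.
have pM k l n : precompose (k * l)%g n = precompose k (precompose l n).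
  by apply/funext => y; rewrite /precompose /= rM.
split=> // k n; apply/eqP; rewrite eq_le le /=.
by rewrite -{1}[n]p1 -(mulVg k) pM le.
Qed.
End Translation.

Lemma sup_norm_ultra : (forall a b, nu (a + b) <= Num.max (nu a) (nu b)) ->
  forall n m, sup_norm (n + m) <= Num.max (sup_norm n) (sup_norm m).
Proof.
move=> nuU n m; apply: sup_norm_le => y; rewrite le_max.
have := nuU (n y) (m y); rewrite le_max => /orP[] h; apply/orP; [left|right];
  [apply: le_trans (sup_norm_ge y n)|apply: le_trans (sup_norm_ge y m)];
  by rewrite /capped le_min !ge_min lexx /= ler_wpM2l ?orbT // ltW.
Qed.

Lemma sup_norm_contract : (forall a, nu a <= 1) ->
  forall n m, sup_norm (n * m) <= sup_norm n /\ sup_norm (n * m) <= sup_norm m.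
Proof.
move=> nu1 n m.
split; apply: sup_norm_mono => y; apply: le_trans (nuM _ _) _.
  by rewrite ler_piMr.
by rewrite ler_piMl.
Qed.

End SupNorm.

(** * Products of transvections *)

Lemma poly_nonroot (R : realFieldType) (P : {poly R}) : P != 0 ->
  exists2 s : R, 0 < s < 1 & P.[s] != 0.
Proof.
move=> P0; apply: contrapT => noroot.
pose rs := [seq i.+2%:R^-1 : R | i <- iota 0 (size P)].
have : (size rs < size P)%N.
  apply: max_poly_roots => //.
    apply/allP => _ /mapP[i _ ->]; apply/rootP/eqP; apply: contrapT => /negP Pi.
    apply: noroot; exists i.+2%:R^-1 => //.
    by rewrite invr_gt0 ltr0n /= invf_lt1 ?ltr0n // ltr1n.
  rewrite map_inj_uniq ?iota_uniq // => i j /invr_inj /eqP.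
  by rewrite eqr_nat => /eqP[].
by rewrite size_map size_iota ltnn.
Qed.

Section Transvections.
Context {R : realFieldType}.

Definition row2 (x y : R) : 'rV[R]_2 := \row_j (if j == 0 then x else y).

Definition col2 (x y : R) : 'cV[R]_2 := \col_i (if i == 0 then x else y).

(** With [v = (- a, 1)] and [omega] the determinant form, this is the map
    [x -> s omega(x, v) v] on row vectors; its square vanishes because
    [omega(v, v)] does. *)
Definition nilmx (s a : R) : 'M[R]_2 := s *: (col2 1 a *m row2 (- a) 1).

Lemma row2_col2 x y z t : row2 x y *m col2 z t = (x * z + y * t)%:M.
Proof.
apply/matrixP => i j; rewrite !ord1 !mxE !big_ord_recl big_ord0 !mxE /=.
by rewrite addr0 mulr1n.
Qed.

Lemma row2D x y z t : row2 x y + row2 z t = row2 (x + z) (y + t).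
Proof. by apply/matrixP => i j; rewrite !mxE; case: ifP. Qed.

Lemma row2Z c x y : c *: row2 x y = row2 (c * x) (c * y).
Proof. by apply/matrixP => i j; rewrite !mxE; case: ifP. Qed.

Lemma nilmx_sq s a : nilmx s a * nilmx s a = 0.
Proof.
rewrite /nilmx -[LHS]/(_ *m _) -scalemxAl -scalemxAr mulmxA -[_ *m col2 _ _]mulmxA.
by rewrite row2_col2 mulr1 mul1r addNr raddf0 mulmx0 mul0mx !scaler0.
Qed.

Lemma row2_nilmx x y s a : row2 x y *m nilmx s a =
  row2 (- (s * (x + y * a) * a)) (s * (x + y * a)).
Proof.
by rewrite /nilmx -scalemxAr mulmxA row2_col2 mul_scalar_mx scalerA row2Z mulr1
  mulr1 mulrN.
Qed.

Definition transvection (s : R) (p : bool * R) : 'M[R]_2 :=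
  if p.1 then 1 + nilmx s p.2 else 1 - nilmx s p.2.

(** The row vector [(1, 0)], or more generally [(p, q)], multiplied by a
    product of transvections whose common parameter [s] is the
    indeterminate. *)
Fixpoint run (p q : {poly R}) (l : seq (bool * R)) : {poly R} * {poly R} :=
  match l with
  | [::] => (p, q)
  | (b, a) :: l' => let t := (-1) ^+ (~~ b) *: ('X * (p + a *: q)) in
      run (p - a *: t) (q + t) l'
  end.

Lemma run_eval s p q l : row2 p.[s] q.[s] *m \prod_(i <- l) transvection s i =
  row2 (run p q l).1.[s] (run p q l).2.[s].
Proof.
elim: l p q => [|[b a] l IH] p q; first by rewrite big_nil mulmx1.
rewrite big_cons -[X in _ *m X]/(_ *m _) mulmxA /= -IH; congr (_ *m _).
rewrite !hornerE; case: b; rewrite /transvection /=.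
  by rewrite mulmxDr mulmx1 row2_nilmx row2D expr0 !mul1r; congr row2; ring.
by rewrite mulmxBr mulmx1 row2_nilmx -scaleN1r row2Z row2D expr1; congr row2;
  ring.
Qed.

(** Pairing the current row with [(1, a)] has maximal degree for every [a]
    other than the one just used, since the leading term is then multiplied by
    a nonzero difference. Hence each factor increases the degree by one as long
    as it differs from the previous one. *)
Lemma run_size n (p q : {poly R}) (l : seq (bool * R)) z :
  (0 < n)%N -> (size p <= n)%N -> (size q <= n)%N ->
  (forall b, b != z -> size (p + b *: q) = n) ->
  path (fun x y => x != y) z (map snd l) -> l != [::] ->
  (n < size (run p q l).2)%N.
Proof.
elim: l n p q z => // -[b a] l IH n p q z n0 pn qn zn /= /andP[za al] _.
set t := _ *: (_ * _).
have tn : size t = n.+1.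
  rewrite /t size_scale ?signr_eq0 // mulrC size_mulX;
    first by rewrite zn // eq_sym.
  by rewrite -size_poly_gt0 zn // eq_sym.
have small (r : {poly R}) : (size r <= n)%N -> size (r + t) = n.+1.
  by move=> rn; rewrite addrC size_polyDl tn ?ltnS.
have qt : size (q + t) = n.+1 by exact: small.
have [->|l0] := eqVneq l [::]; first by rewrite /= qt.
apply: ltnW; apply: (IH n.+1 _ _ a) => //.
- apply: leq_trans (size_polyD _ _) _;
  rewrite size_polyN geq_max (leq_trans pn) //=.
  by apply: leq_trans (size_scale_leq _ _) _; rewrite tn.
- by rewrite qt.
- move=> c ca.
  have -> : p - a *: t + c *: (q + t) = (p + c *: q) + (c - a) *: t.
    by rewrite scalerDr scalerBl; ring.
  rewrite addrC size_polyDl size_scale ?subr_eq0 // tn // ltnS.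
  apply: leq_trans (size_polyD _ _) _; rewrite geq_max pn.
  exact: leq_trans (size_scale_leq _ _) qn.
Qed.

(** The second coordinate of the image of [(1, 0)] is a nonzero polynomial in
    [s], while it would vanish if the product were 1. *)
Lemma transvection_prod_neq1 z (l : seq (bool * R)) : l != [::] ->
  path (fun x y => x != y) z (map snd l) ->
  exists2 s, 0 < s < 1 & \prod_(i <- l) transvection s i != 1.
Proof.
move=> l0 lz.
have r1 : (1 < size (run 1 0 l).2)%N.
  apply: (@run_size 1 1 0 l z) => //; rewrite ?size_poly1 ?size_poly0 //.
  by move=> b _; rewrite scaler0 addr0 size_poly1.
have /poly_nonroot[s s01 sr] : (run 1 0 l).2 != 0.
  by rewrite -size_poly_gt0 (ltn_trans _ r1).
exists s => //; apply: contra_neq sr => prod1.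
have := run_eval s 1 0 l; rewrite prod1 mulmx1 => /matrixP/(_ 0 1).
by rewrite !mxE /= horner0.
Qed.

End Transvections.

Section Separation.
Context {R : realFieldType} (K : choiceType) (W : Type).
Variable good : (K -> R) -> W -> Prop.
Hypothesis good_cst : exists u w, good u w.
Hypothesis good_sep : forall x y, x != y -> exists u w, good u w /\ u x != u y.
Hypothesis good_conv : forall u v w w' e, good u w -> good v w' -> 0 < e < 1 ->
  exists w'', good (fun x => (1 - e) * u x + e * v x) w''.

(** Given [u] separating all pairs but one and [v] separating the last one,
    each pair forbids at most one [e] in the combination
    [(1 - e) u + e v]. *)
Lemma separate_pairs (ps : seq (K * K)) : all (fun p => p.1 != p.2) ps ->
  exists u w, good u w /\ all (fun p => u p.1 != u p.2) ps.
Proof.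
elim: ps => [_|p ps IH /= /andP[p12 /IH[u [w [uw up]]]]].
  by have [u [w uw]] := good_cst; exists u, w.
have [v [w' [vw vp]]] := good_sep p12.
(* [L q] is the difference of the values of the combination at [q], as a
   polynomial in [e]. *)
pose L (q : K * K) : {poly R} :=
  (u q.1 - u q.2)%:P + (v q.1 - v q.2 - (u q.1 - u q.2)) *: 'X.
have Le q e : (L q).[e] = ((1 - e) * u q.1 + e * v q.1) - ((1 - e) * u q.2 + e * v q.2).
  by rewrite /L !hornerE; ring.
have L0 q : (L q).[0] = u q.1 - u q.2 by rewrite Le; ring.
have L1 q : (L q).[1] = v q.1 - v q.2 by rewrite Le; ring.
have Lp : L p != 0.
  by apply: contraNneq vp => Lp; rewrite -subr_eq0 -L1 Lp horner0.
have Lps : \prod_(q <- ps) L q != 0.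
  rewrite prodf_seq_neq0; apply/allP => q qps /=.
  apply: contraTneq (allP up _ qps) => Lq.
  by rewrite negbK -subr_eq0 -L0 Lq horner0.
have /poly_nonroot[e e01] : \prod_(q <- p :: ps) L q != 0.
  by rewrite big_cons mulf_neq0.
rewrite horner_prod prodf_seq_neq0 => /allP Pe.
have [w'' uvw] := good_conv uw vw e01.
pose c x := (1 - e) * u x + e * v x.
exists c, w''; split; first exact: uvw.
apply: (introT (@allP _ (fun q => c q.1 != c q.2) (p :: ps))) => q qps.
by have := Pe q qps; rewrite /= Le subr_eq0.
Qed.

Lemma separate_path z ks : path (fun k l => k != l) z ks ->
  exists u w, good u w /\ path (fun a b => a != b) (u z) (map u ks).
Proof.
have pathE (T : eqType) (f : K -> T) x s :
    path (fun a b => a != b) (f x) (map f s) =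
    all (fun p => f p.1 != f p.2) (zip (x :: s) s).
  by elim: s x => //= y s IH x; rewrite IH.
rewrite -[ks in path _ _ ks]map_id (pathE _ id) => /separate_pairs[u [w [uw up]]].
by exists u, w; rewrite pathE.
Qed.

End Separation.

(** * The group of matrix functions acted upon by translation *)

(** Common properties of the usual norm and of the discrete norm: [sigma] is
    the norm on scalars and [W] the set of weights allowed in the supremum.
    The last condition fails for small weights and an unbounded norm; this is
    why [W] is [{1}] in one case and the interval ]0, 1] in the other. *)
Record coefficient_norm (R : realType) (sigma : R -> R) (nu : 'M[R]_2 -> R)
    (W : set R) : Prop := CoefficientNorm {
  nu_ge0 : forall a, 0 <= nu a;
  nu_eq0 : forall a, nu a = 0 <-> a = 0;
  nuN : forall a, nu (- a) = nu a;
  nuD : forall a b, nu (a + b) <= nu a + nu b;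
  nuM : forall a b, nu (a * b) <= nu a * nu b;
  nu_complete : mcomplete (fun a b => nu (a - b));
  nu_nilp : forall s a, 0 <= s <= 1 -> 0 <= a <= 1 -> nu (nilmx s a) <= 4;
  nu_nilpB : forall s a b, 0 <= s <= 1 -> 0 <= a <= 1 -> 0 <= b <= 1 ->
    nu (nilmx s a - nilmx s b) <= 4 * sigma (a - b);
  weight_gt0 : forall w, W w -> 0 < w;
  weight_nu : forall w a, W w -> w * nu a < 1 -> nu a <= 1 }.

Section TransvectionRing.
Context {R : realType} (sigma : R -> R) (nu : 'M[R]_2 -> R) (W : set R).
Hypothesis hnu : coefficient_norm sigma nu W.
Variables (K : groupType) (dK del : K -> K -> R).
Hypotheses (hK : metric_group dK) (del_inv : left_invariant_metric del).
Hypothesis dK_del : mcontinuous dK del id.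

(** With the usual norm and [w = 1] this says that [u] is 1-Lipschitz; with
    the discrete norm, that [u] takes the same value at points at distance less
    than [w]. *)
Definition lipschitz_test (u : K -> R) (w : R) : Prop :=
  [/\ W w, forall x, 0 <= u x <= 1 & forall x y, w * sigma (u x - u y) <= del x y].

Hypothesis test_cst : exists u w, lipschitz_test u w.
Hypothesis test_sep : forall x y, x != y ->
  exists u w, lipschitz_test u w /\ u x != u y.
Hypothesis test_conv : forall u v w w' e,
  lipschitz_test u w -> lipschitz_test v w' -> 0 < e < 1 ->
  exists w'', lipschitz_test (fun x => (1 - e) * u x + e * v x) w''.

Record test_point := TestPoint {
  test_fun : K -> R;
  test_weight : R;
  test_param : R;
  test_funP : lipschitz_test test_fun test_weight;
  test_paramP : 0 <= test_param <= 1 }.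

Lemma test_point_eq y z : test_fun y = test_fun z ->
  test_weight y = test_weight z -> test_param y = test_param z -> y = z.
Proof.
case: y z => [u w s uw s01] [u' w' s' uw' s01'] /= uu ww ss.
subst u' w' s'; congr TestPoint; exact: Prop_irrelevance.
Qed.

Lemma test_shift k u w : lipschitz_test u w ->
  lipschitz_test (fun x => u (k * x)%g) w.
Proof. by move=> [Ww u01 uw]; split=> // x y; rewrite -(del_inv k). Qed.

Definition shift (k : K) (y : test_point) : test_point :=
  TestPoint (test_shift k (test_funP y)) (test_paramP y).

Lemma shift1 y : shift 1%g y = y.
Proof. by apply: test_point_eq => //=; apply/funext => x; rewrite mul1g. Qed.

Lemma shiftM k l y : shift (k * l)%g y = shift l (shift k y).
Proof. by apply: test_point_eq => //=; apply/funext => x; rewrite mulgA. Qed.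

Lemma test_point_inhabited : exists y : test_point, True.
Proof.
have [u [w uw]] := test_cst; have s01 : 0 <= (0 : R) <= 1 by rewrite lexx ler01.
by exists (TestPoint uw s01).
Qed.

Let y0 : test_point := sval (cid test_point_inhabited).
Let B := (test_point -> 'M[R]_2).
Let N : B -> R := sup_norm nu test_weight.
Let act : K -> B -> B := precompose shift.

Let wgt0 y : 0 < test_weight y.
Proof. by have [/(weight_gt0 hnu)] := test_funP y. Qed.

Let wnu y a : test_weight y * nu a < 1 -> nu a <= 1.
Proof. by have [Ww _ _] := test_funP y; exact: (weight_nu hnu Ww). Qed.

Lemma test_ring_norm : ring_norm N.
Proof.
exact: (sup_norm_ring_norm y0 (nu_ge0 hnu) (nu_eq0 hnu) (nuN hnu) (nuD hnu)
  (nuM hnu) wgt0 wnu).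
Qed.

Lemma test_complete : mcomplete (norm_dist N).
Proof.
exact: (sup_norm_complete y0 (nuD hnu) wgt0 (nu_complete hnu)).
Qed.

Lemma test_action : isometric_action N act.
Proof.
exact: (precompose_isometric y0 nu shift1 shiftM).
Qed.

(** Translating by [k] replaces [u 1] with [u k]: the translates of this
    element by distinct points are distinguished by the values of [u]. *)
Definition test_nilp : B := fun y => nilmx (test_param y) (test_fun y 1%g).

Lemma test_nilmx_sq : test_nilp * test_nilp = 0.
Proof. by apply/funext => y; exact: nilmx_sq. Qed.

(** Translates by [k] and [l] differ at [(u, s)] by at most a multiple of
    [u k - u l], which is bounded by the distance of [k] and [l] uniformly in
    [u]. *)
Lemma test_nilp_controlled : controlled dK N act test_nilp.
Proof.
split.
  apply: (bounded_multiplier y0 (nu_ge0 hnu) (nuM hnu) wgt0 (C := 4)).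
    by rewrite ler1n.
  move=> y; have [_ u01 _] := test_funP y.
  by apply: (nu_nilp hnu) => //; exact: test_paramP.
move=> k e e0; have [c c0 kc] := dK_del k (divr_gt0 e0 (ltr0n R 8)).
exists c => // l /kc kl.
apply: (@le_lt_trans _ _ (4 * del k l)); last by lra.
apply: (sup_norm_le y0) => y; have [_ u01 uw] := test_funP y.
rewrite ge_min; apply/orP; right.
have := ler_wpM2l (ltW (wgt0 y)) (nu_nilpB hnu (test_paramP y) (u01 k) (u01 l)).
suff -> : (act k test_nilp - act l test_nilp) y =
    nilmx (test_param y) (test_fun y k) - nilmx (test_param y) (test_fun y l).
  by move=> /le_trans; apply; rewrite mulrCA ler_wpM2l.
by congr (nilmx _ (test_fun y _) - nilmx _ (test_fun y _)); exact: mulg1.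
Qed.

Let c1 : controlled dK N act 1.
Proof. exact: (controlled1 _ test_ring_norm test_action). Qed.

Let cB x y : controlled dK N act x -> controlled dK N act y ->
  controlled dK N act (x - y).
Proof. exact: (controlledB test_ring_norm test_action). Qed.

Local Notation T := (semidirect hK test_ring_norm test_action).

Lemma test_transvection_subproof :
  is_unit_pair dK N act (1%g, (1 + test_nilp, 1 - test_nilp)).
Proof.
have X2 := test_nilmx_sq; have Xc := test_nilp_controlled.
apply/asboolP; split => /=.
- by rewrite mulrBr mulr1 mulrDl mul1r X2 addr0 addrK.
- by rewrite mulrDr mulr1 mulrBl mul1r X2 subr0 subrK.
- rewrite -[test_nilp]opprK; apply: (cB c1).
  have -> : - test_nilp = (1 - test_nilp) - 1 by rewrite addrC addKr.
  exact: cB (cB c1 Xc) c1.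
- exact: cB.
Qed.

Definition test_transvection : T :=
  Sub (1%g, (1 + test_nilp, 1 - test_nilp)) test_transvection_subproof.

(** Evaluate at a test point whose function separates consecutive points and
    whose parameter avoids the roots of a polynomial. *)
Lemma test_translates_free z (l : seq (bool * K)) : l != [::] ->
  path (fun k l => k != l) z (map snd l) ->
  \prod_(p <- l) translate test_transvection p != 1.
Proof.
move=> l0 lz; have [u [w [uw uz]]] :=
  separate_path test_cst test_sep test_conv lz.
pose l' := [seq (p.1, u p.2) | p <- l].
have l'0 : l' != [::] by rewrite -size_eq0 size_map size_eq0.
have /(transvection_prod_neq1 l'0)[s /andP[s0 s1] prod1] :
    path (fun x y => x != y) (u z) (map snd l').
  by move: uz; rewrite -!map_comp.
have s01 : 0 <= s <= 1 by rewrite !ltW.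
pose y := TestPoint uw s01.
apply: contra_neq prod1 => /(congr1 (fun n : B => n y)).
have -> : (\prod_(p <- l) translate test_transvection p) y =
    \prod_(p <- l) (translate test_transvection p y).
  exact: (big_morph (fun n : B => n y)).
move=> prod_y; transitivity ((1 : B) y); last by [].
rewrite -prod_y big_map; apply: eq_bigr => -[b k] _.
rewrite /translate /transvection /sd_unit /sd_inverse /= /act /precompose /=.
have Xk : test_nilp (shift k y) = nilmx s (u k) by rewrite /test_nilp /= mulg1.
by case: b; rewrite /= -Xk.
Qed.

End TransvectionRing.

(** * The usual norm and the discrete norm *)

Section ArchimedeanNorm.
Context {R : realType}.

(** The sum, unlike the maximum, of the entries is submultiplicative. *)
Definition entry_norm (A : 'M[R]_2) : R := \sum_i \sum_j `|A i j|.

Lemma entry_norm_ge (A : 'M[R]_2) i j : `|A i j| <= entry_norm A.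
Proof.
rewrite /entry_norm (bigD1 i) //= (bigD1 j) //= -addrA lerDl.
by rewrite addr_ge0 ?sumr_ge0 // => k _; rewrite sumr_ge0.
Qed.

Lemma entry_norm2 (A : 'M[R]_2) :
  entry_norm A = `|A 0 0| + `|A 0 1| + (`|A 1 0| + `|A 1 1|).
Proof.
rewrite /entry_norm !big_ord_recl !big_ord0 !addr0.
by congr (`|A _ _| + `|A _ _| + (`|A _ _| + `|A _ _|)); exact/val_inj.
Qed.

Lemma nilmxE (s a : R) : [/\ nilmx s a 0 0 = - (s * a), nilmx s a 0 1 = s,
  nilmx s a 1 0 = - (s * (a * a)) & nilmx s a 1 1 = s * a] :> Prop.
Proof.
rewrite /nilmx; split; rewrite !mxE !big_ord_recl big_ord0 !mxE /=; ring.
Qed.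

Lemma real_complete (u : nat -> R) :
  (forall e : R, 0 < e -> exists N : nat, forall m n : nat,
    (N <= m)%N -> (N <= n)%N -> `|u m - u n| < e) ->
  exists l, forall e : R, 0 < e -> exists N : nat, forall n, (N <= n)%N ->
    `|l - u n| < e.
Proof.
move=> uC.
have /cauchy_cvgP/cvg_ex[l ul] : cauchy (u @ \oo).
  apply/cauchy_exP => e /uC[N uN]; exists (u N); exists N => // n /= Nn.
  exact: uN.
exists l => e e0; have /cvgrPdist_lt /(_ e e0) [N _ lN] := ul.
by exists N => n /lN.
Qed.

Lemma archimedean_coefficient_norm :
  coefficient_norm (fun a : R => `|a|) entry_norm [set 1].
Proof.
split.
- by move=> A; rewrite sumr_ge0 // => i _; rewrite sumr_ge0.
- move=> A; split=> [A0|->].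
    apply/matrixP => i j; rewrite mxE; apply/eqP; rewrite -normr_le0 -A0.
    exact: entry_norm_ge.
  by rewrite /entry_norm big1 // => i _; rewrite big1 // => j _;
    rewrite mxE normr0.
- move=> A; rewrite /entry_norm; apply: eq_bigr => i _; apply: eq_bigr => j _.
  by rewrite mxE normrN.
- move=> A A'; rewrite /entry_norm -big_split; apply: ler_sum => i _ /=.
  by rewrite -big_split; apply: ler_sum => j _ /=; rewrite mxE ler_normD.
- move=> A A'; rewrite !entry_norm2 -![(A * A') _ _]/((A *m A') _ _) !mxE.
  rewrite !big_ord_recl !big_ord0 !addr0.
  have -> : lift ord0 ord0 = 1 :> 'I_2 by exact/val_inj.
  rewrite -![ord0]/(0 : 'I_2).
  apply: le_trans (lerD (lerD (ler_normD _ _) (ler_normD _ _))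
    (lerD (ler_normD _ _) (ler_normD _ _))) _.
  rewrite !normrM -subr_ge0.
  set a := `|A 0 0|; set b := `|A 0 1|; set c := `|A 1 0|; set d := `|A 1 1|.
  set p := `|A' 0 0|; set q := `|A' 0 1|; set r := `|A' 1 0|; set s :=
    `|A' 1 1|.
  have -> : (a + b + (c + d)) * (p + q + (r + s)) -
      (a * p + b * r + (a * q + b * s) + (c * p + d * r + (c * q + d * s))) =
      a * r + a * s + b * p + b * q + c * r + c * s + d * p + d * q by ring.
  by rewrite !addr_ge0 ?mulr_ge0 ?normr_ge0.
- move=> u uC.
  have ent i j : exists l, forall e : R, 0 < e ->
      exists N : nat, forall n, (N <= n)%N -> `|l - u n i j| < e.
    apply: (@real_complete (fun n => u n i j)) => e /uC[N uN];
      exists N => m n mN nN.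
    apply: le_lt_trans (uN m n mN nN); apply: le_trans (entry_norm_ge _ i j).
    by rewrite !mxE.
  have [l lP] := choice (fun ij : 'I_2 * 'I_2 => ent ij.1 ij.2).
  exists (\matrix_(i, j) l (i, j)) => e e0.
  have e4 : 0 < e / 4 by rewrite divr_gt0.
  have [N1 h1] := lP (0, 0) _ e4; have [N2 h2] := lP (0, 1) _ e4.
  have [N3 h3] := lP (1, 0) _ e4; have [N4 h4] := lP (1, 1) _ e4.
  exists (maxn (maxn N1 N2) (maxn N3 N4)) => n.
  rewrite !geq_max => /andP[/andP[/h1 + /h2 +] /andP[/h3 + /h4 +]].
  by rewrite entry_norm2 !mxE /=; lra.
- move=> s a s01 a01; rewrite entry_norm2; have [-> -> -> ->] := nilmxE s a.
  rewrite !normrN !normrM !ger0_norm; nra.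
- move=> s a b s01 a01 b01.
  have BE i j : (nilmx s a - nilmx s b) i j = nilmx s a i j - nilmx s b i j.
    by rewrite mxE; congr (_ + _); rewrite mxE.
  rewrite entry_norm2 !BE.
  have [-> -> -> ->] := nilmxE s a; have [-> -> -> ->] := nilmxE s b.
  have -> : - (s * a) - - (s * b) = - (s * (a - b)) by ring.
  have -> : - (s * (a * a)) - - (s * (b * b)) = - (s * ((a - b) * (a + b))) by ring.
  rewrite subrr normr0 -mulrBr !normrN !normrM.
  have := normr_ge0 (a - b); set d := `|a - b| => d0.
  rewrite !ger0_norm; [|lra|lra].
  have /andP[sd0 sd] : 0 <= s * d <= d by nra.
  have -> : s * (d * (a + b)) = (s * d) * (a + b) by ring.
  nra.
- by move=> _ ->.
- by move=> _ a ->; rewrite mul1r => /ltW.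
Qed.

Section Tests.
Variables (K : groupType) (del : K -> K -> R).
Hypothesis delm : is_metric del.
Local Notation test := (lipschitz_test (fun a : R => `|a|) [set 1] del).

Lemma archimedean_test_cst : exists u w, test u w.
Proof.
exists (fun=> 0), 1; split=> // [x|x y]; first by rewrite lexx ler01.
by rewrite subrr normr0 mulr0; case: delm.
Qed.

Lemma archimedean_test_sep x y : x != y -> exists u w, test u w /\ u x != u y.
Proof.
case: delm => d0 dxy ds dt xy.
exists (fun z => Num.min 1 (del x z)), 1; split; first split=> // [z|z t].
- by rewrite le_min ler01 d0 ge_min lexx.
- rewrite mul1r; have := dt x z t; have := dt x t z; rewrite (ds t z).
  have := d0 z t; rewrite ler_norml.
  by case: (leP 1 (del x z)); case: (leP 1 (del x t)); lra.
- have -> : del x x = 0 by exact/dxy.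
  have xy0 : del x y != 0 by apply: contra_neq xy => /dxy.
  by rewrite (min_idPr ler01) eq_sym gt_eqF // lt_min ltr01 lt_neqAle eq_sym xy0 d0.
Qed.

Lemma archimedean_test_conv u v w w' e : test u w -> test v w' -> 0 < e < 1 ->
  exists w'', test (fun x => (1 - e) * u x + e * v x) w''.
Proof.
move=> [/= -> u01 uL] [/= -> v01 vL] e01; exists 1; split=> // [x|x y].
  have := u01 x; have := v01 x; nra.
have := uL x y; have := vL x y; rewrite !mul1r => vxy uxy.
have -> : (1 - e) * u x + e * v x - ((1 - e) * u y + e * v y) =
  (1 - e) * (u x - u y) + e * (v x - v y) by ring.
apply: le_trans (ler_normD _ _) _.
rewrite !normrM (@ger0_norm _ (1 - e)); last by lra.
rewrite (@ger0_norm _ e); last by lra.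
nra.
Qed.
End Tests.
End ArchimedeanNorm.

Section DiscreteNorm.
Context {R : realType}.

Definition discrete_norm (V : nmodType) (a : V) : R := (a != 0)%:R.

Lemma discrete_norm_ge0 (V : nmodType) (a : V) : 0 <= discrete_norm a.
Proof. exact: ler0n. Qed.

Lemma discrete_norm_le1 (V : nmodType) (a : V) : discrete_norm a <= 1.
Proof. by rewrite /discrete_norm; case: eqP. Qed.

Lemma discrete_norm_eq0 (V : nmodType) (a : V) : discrete_norm a = 0 <-> a = 0.
Proof.
rewrite /discrete_norm; case: eqP => [->|a0]; split=> //.
by move=> /eqP; rewrite oner_eq0.
Qed.

Lemma discrete_norm_ultra (V : nmodType) (a b : V) :
  discrete_norm (a + b) <= Num.max (discrete_norm a) (discrete_norm b).
Proof.
rewrite /discrete_norm le_max; have [->|a0] := eqVneq a 0.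
  by rewrite add0r lexx orbT.
by case: (a + b != 0); rewrite ?lexx ?ler01.
Qed.

Lemma discrete_coefficient_norm :
  coefficient_norm (@discrete_norm R) (@discrete_norm 'M[R]_2)
    [set w | 0 < w <= 1].
Proof.
split.
- exact: discrete_norm_ge0.
- exact: discrete_norm_eq0.
- by move=> a; rewrite /discrete_norm oppr_eq0.
- move=> a b; apply: le_trans (discrete_norm_ultra _ _) _.
  by rewrite ge_max lerDl lerDr !discrete_norm_ge0.
- move=> a b; rewrite /discrete_norm.
  have [->|_] := eqVneq a 0; first by rewrite mul0r eqxx mul0r.
  have [->|_] := eqVneq b 0; first by rewrite mulr0 eqxx mulr0.
  by rewrite mulr1; case: eqP.
- move=> u /(_ 1 ltr01)[N uN]; exists (u N) => e e0; exists N => n nN.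
  have := uN N n (leqnn _) nN; rewrite /discrete_norm.
  by case: eqP => //= _; rewrite ltxx.
- by move=> s a _ _; apply: le_trans (discrete_norm_le1 _) _; rewrite ler1n.
- move=> s a b _ _ _; rewrite /discrete_norm !subr_eq0.
  have [->|_] := eqVneq a b; first by rewrite !eqxx mulr0.
  by rewrite mulr1; case: eqP => _ //=; rewrite ?ler1n ?ler0n.
- by move=> w /andP[].
- by move=> w a _ _; exact: discrete_norm_le1.
Qed.

Section Tests.
Variables (K : groupType) (del : K -> K -> R).
Hypothesis delu : is_ultrametric del.
Local Notation test :=
  (lipschitz_test (@discrete_norm R) [set w | 0 < w <= 1] del).

Lemma discrete_test_cst : exists u w, test u w.
Proof.
exists (fun=> 0), 1; split=> /= [|x|x y]; rewrite ?ltr01 ?lexx ?ler01 //.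
by rewrite subrr /discrete_norm eqxx mulr0; case: delu => -[].
Qed.

(** The indicator of a ball: in an ultrametric space, points at distance less
    than the radius lie both inside or both outside. *)
Lemma discrete_test_sep x y : x != y -> exists u w, test u w /\ u x != u y.
Proof.
case: delu => -[d0 dxy ds _] dt xy.
have w0 : 0 < Num.min 1 (del x y).
  rewrite lt_min ltr01 lt_neqAle eq_sym d0 andbT.
  by apply: contra_neq xy => /dxy.
set w := Num.min _ _ in w0.
have w1 : w <= 1 by rewrite ge_min lexx.
have near z t : del z t < w -> del x z < w -> del x t < w.
  by move=> zt xz; apply: le_lt_trans (dt x t z) _; rewrite gt_max xz.
exists (fun z => (del x z < w)%R%:R), w; split; first split=> [|z|z t].
- by rewrite /= w0.
- by case: (_ < _); rewrite lexx ler01.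
- have [zt|zt] := ltP (del z t) w; last first.
    apply: le_trans zt; rewrite ler_piMr ?(ltW w0) //; exact: discrete_norm_le1.
  have -> : (del x z < w) = (del x t < w).
    by apply/idP/idP; apply: near => //; rewrite ds.
  by rewrite subrr /discrete_norm eqxx mulr0.
- have -> : del x x = 0 by exact/dxy.
  by rewrite w0 /w lt_min ltxx andbF oner_neq0.
Qed.

Lemma discrete_test_conv u v w w' e : test u w -> test v w' -> 0 < e < 1 ->
  exists w'', test (fun x => (1 - e) * u x + e * v x) w''.
Proof.
move=> [/= /andP[w0 w1] u01 uL] [/= /andP[w'0 w'1] v01 vL] e01.
exists (Num.min w w'); split=> [|x|x y] /=.
- by rewrite lt_min w0 w'0 ge_min w1.
- have := u01 x; have := v01 x; nra.
- have d0 : 0 <= del x y by case: delu => -[].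
  have min_le (a : R) : Num.min w w' * discrete_norm a <= Num.min w w'.
    by rewrite ler_piMr ?discrete_norm_le1 // le_min !ltW.
  have := uL x y; have := vL x y; rewrite {1 2}/discrete_norm !subr_eq0.
  have [->|_ _] := eqVneq (u x) (u y); last first.
    by rewrite mulr1 => wd; apply: le_trans (min_le _) _; rewrite ge_min wd.
  have [->|_] := eqVneq (v x) (v y).
    by move=> _ _; rewrite subrr /discrete_norm eqxx mulr0.
  by rewrite mulr1 => wd _; apply: le_trans (min_le _) _;
    rewrite ge_min wd orbT.
Qed.
End Tests.
End DiscreteNorm.

(** * Left invariant metrization *)

Section LeftUniformity.
Context {R : realType} (G : groupType) (d : G -> G -> R).
Hypothesis h : metric_group d.
Local Open Scope relation_scope.

Definition left_uniform : Type := let _ := h in G.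
Local Notation U := left_uniform.

HB.instance Definition _ := Choice.on U.

Definition left_entourage : set_system (U * U) :=
  filter_from [set e : R | 0 < e]
    (fun e => [set xy : G * G | d 1%g (xy.1^-1 * xy.2)%g < e]).

Let dm : is_metric d. Proof. by case: h. Qed.

Lemma left_entourage_filter : Filter left_entourage.
Proof.
apply: filter_from_filter; first by exists 1 => /=.
move=> e f /= e0 f0; exists (Num.min e f); first by rewrite /= lt_min e0.
by move=> xy /=; rewrite lt_min => /andP[].
Qed.

Lemma left_entourage_refl A : left_entourage A -> diagonal `<=` A.
Proof.
move=> [e e0 eA] [x y] /diagonalP <-; apply: eA.
by rewrite /= mulVg (metric_refl _ dm).
Qed.

Lemma left_entourage_inv A : left_entourage A -> left_entourage A^-1.
Proof.
move=> [e e0 eA]; have [_ _ /(_ 1%g e e0)[c c0 cV]] := h.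
exists c => // -[x y] /= xy; apply: eA => /=.
by move: (cV _ xy); rewrite invg1 invgM invgK.
Qed.

Lemma left_entourage_split A :
  left_entourage A -> exists2 B, left_entourage B & B \; B `<=` A.
Proof.
move=> [e e0 eA]; have [_ /(_ 1%g 1%g e e0)[c c0 cM] _] := h.
exists [set xy : G * G | d 1%g (xy.1^-1 * xy.2)%g < c]; first by exists c.
move=> [x z] /= [y /= xy yz]; apply: eA => /=.
by move: (cM _ _ xy yz); rewrite mulg1 mulgA mulgK.
Qed.

HB.instance Definition _ := @isUniform.Build U left_entourage
  left_entourage_filter left_entourage_refl left_entourage_inv
  left_entourage_split.

Lemma left_countable_uniformity : countable_uniformity U.
Proof.
apply/countable_uniformityP.
exists (fun n => [set xy : G * G | d 1%g (xy.1^-1 * xy.2)%g < (n.+1%:R^-1)%R]).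
  move=> A [e e0 eA]; have [n ne] := ltr_add_invr (y := 0) (x := e) e0.
  exists n; apply: subset_trans eA => xy /=; move=> /lt_trans; apply.
  by rewrite add0r in ne.
by move=> n; exists (n.+1%:R^-1)%R => //=; rewrite invr_gt0.
Qed.

End LeftUniformity.

(** The left uniformity has a countable base, hence it is defined by a family
    of balls. These need not be invariant, but requiring all left translates
    of a pair to be close gives invariant balls with the same properties; as
    the entourages are invariant, they still define the left uniformity. *)
Lemma left_invariant_metrization (R : realType) (G : groupType)
    (d : G -> G -> R) : metric_group d ->
  exists del : G -> G -> R, [/\ is_metric del, left_invariant_metric del,
    mcontinuous d del id & mcontinuous del d id].
Proof.
move=> h; have dm : is_metric d by case: h.
pose M := countable_uniform.type (left_countable_uniformity h).
pose b (x : G) (e : R) (y : G) := forall p : G,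
  @ball R M (p * x)%g e (p * y)%g.
(* The element 1 keeps the set nonempty, so the infimum is capped at 1. *)
pose S (x y : G) := [set e : R | e = 1 \/ 0 < e /\ b x e y].
pose del x y := inf (S x y).
have S_ge0 x y : lbound (S x y) 0 by move=> e [->|[/ltW]].
have del_ge0 x y : 0 <= del x y.
  by apply: lb_le_inf; [exists 1; left|exact: S_ge0].
have del_le x y e : S x y e -> del x y <= e.
  by apply: ge_inf; exists 0; exact: S_ge0.
have del_lt x y e : del x y < e -> exists2 f, S x y f & f < e.
  by move=> /inf_lt; apply; exists 1; left.
have del_inv : left_invariant_metric del.
  move=> p x y; congr inf; apply/seteqP; split=> e -[->|[e0 xy]]; try by left.
    right; split=> // q; have := xy (q * p^-1)%g; by rewrite !mulgA !mulgVK.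
  by right; split=> // q; rewrite !mulgA.
have ball_of_del x y e : e <= 1 -> del x y < e ->
  exists2 f, f < e & 0 < f /\ b x f y.
  move=> e1 /del_lt[f [->|fb] fe]; last by exists f.
  by move: (lt_le_trans fe e1); rewrite ltxx.
have del_d : mcontinuous del d id.
  move=> x e e0; have [_ /(_ x 1%g e e0)[c c0 cM] _] := h.
  have : @left_entourage R G d h [set xy : G * G | d 1%g (xy.1^-1 * xy.2)%g < c].
    by exists c.
  rewrite -[@left_entourage R G d h]/(@entourage M) -(@entourage_ballE R M).
  move=> [f f0 fA]; exists (Num.min f 1); first by rewrite lt_min f0 ltr01.
  move=> y xy; have [|g gf [g0 bg]] := ball_of_del x y _ _ xy.
    by rewrite ge_min lexx orbT.
  have xyc : d 1%g (x^-1 * y)%g < c.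
    apply: (fA (x, y)) => /=; apply: le_ball (ltW (lt_le_trans gf _)) _ _.
      by rewrite ge_min lexx.
    by have := bg 1%g; rewrite !mul1g.
  by have := cM x (x^-1 * y)%g; rewrite (metric_refl _ dm) mulg1 mulVKg; apply.
have d_del : mcontinuous d del id.
  move=> x e e0; have e2 : 0 < e / 2 by rewrite divr_gt0.
  have [c c0 cb] : @left_entourage R G d h [set xy : M * M | ball xy.1 (e / 2) xy.2].
    rewrite -[@left_entourage R G d h]/(@entourage M) -(@entourage_ballE R M).
    by exists (e / 2).
  have [_ /(_ x^-1%g x c c0)[a a0 aM] _] := h.
  exists a => // y xy; apply: (@le_lt_trans _ _ (e / 2)); last by lra.
  apply: del_le; right; split=> // p.
  apply: (cb (p * x, p * y)%g) => /=.
  have := aM x^-1%g y; rewrite (metric_refl _ dm) mulVg invgM -mulgA mulKg.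
  by apply.
have bS x y e : b x e y -> b y e x by move=> xy p; exact: ball_sym.
have [d0 dxy ds dt] := dm.
exists del; split=> //; split=> //.
- move=> x y; split=> [xy|->].
    apply/dxy/eqP; rewrite eq_le d0 andbT leNgt; apply/negP => dxy0.
    have [c c0 /(_ y)] := del_d x _ dxy0; rewrite xy => /(_ c0).
    by rewrite ltxx.
  apply/eqP; rewrite eq_le del_ge0 andbT; apply/ler_addgt0Pr => e e0.
  by rewrite add0r; apply: del_le; right; split=> // p; exact: ballxx.
- move=> x y; congr inf; apply/seteqP; split=> e -[->|[e0 xy]]; try by left.
    by right; split=> //; exact: bS.
  by right; split=> //; exact: bS.
- move=> x y z; apply/ler_addgt0Pr => e e0.
  have e2 : 0 < e / 2 by rewrite divr_gt0.
  have [|f fS fx] := @del_lt x z (del x z + e / 2); first by rewrite ltrDl.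
  have [|g gS gz] := @del_lt z y (del z y + e / 2); first by rewrite ltrDl.
  have [f0 g0] : 0 <= f /\ 0 <= g by split; [exact: S_ge0 fS|exact: S_ge0 gS].
  have del1 : del x y <= 1 by apply: del_le; left.
  case: fS => [f1|[f0' xz]]; first by lra.
  case: gS => [g1|[g0' zy]]; first by lra.
  suff : del x y <= f + g by lra.
  apply: del_le; right; split; first exact: addr_gt0.
  by move=> p; exact: ball_triangle (xz p) (zy p).
Qed.

(** * Direct products *)

Section ProductGroup.
Variables G H : groupType.

Definition prod_group : Type := (G * H)%type.

HB.instance Definition _ := Choice.on prod_group.

Definition prod_mul (x y : prod_group) : prod_group :=
  ((x.1 * y.1)%g, (x.2 * y.2)%g).
Definition prod_inv (x : prod_group) : prod_group := ((x.1)^-1%g, (x.2)^-1%g).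
Definition prod_one : prod_group := (1%g, 1%g).

Lemma prod_mulA : associative prod_mul.
Proof. by move=> x y z; rewrite /prod_mul /= !mulgA. Qed.

Lemma prod_mul1 : left_id prod_one prod_mul.
Proof. by move=> [x y]; rewrite /prod_mul /= !mul1g. Qed.

Lemma prod_mulr1 : right_id prod_one prod_mul.
Proof. by move=> [x y]; rewrite /prod_mul /= !mulg1. Qed.

Lemma prod_mulV : left_inverse prod_one prod_inv prod_mul.
Proof. by move=> [x y]; rewrite /prod_mul /= !mulVg. Qed.

Lemma prod_mulrV : right_inverse prod_one prod_inv prod_mul.
Proof. by move=> [x y]; rewrite /prod_mul /= !mulgV. Qed.

HB.instance Definition _ :=
  isGroup.Build prod_group prod_mulA prod_mul1 prod_mulr1 prod_mulV prod_mulrV.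

Definition prod_inl (x : G) : prod_group := (x, 1%g).
Definition prod_inr (y : H) : prod_group := (1%g, y).

Lemma prod_inlM : {morph prod_inl : x y / (x * y)%g}.
Proof. by move=> x y; congr pair; rewrite /= mulg1. Qed.

Lemma prod_inl1 : prod_inl 1%g = 1%g. Proof. by []. Qed.

Lemma prod_inrM : {morph prod_inr : x y / (x * y)%g}.
Proof. by move=> x y; congr pair; rewrite /= mulg1. Qed.

Lemma prod_inr1 : prod_inr 1%g = 1%g. Proof. by []. Qed.

HB.instance Definition _ :=
  isMultiplicative.Build G prod_group prod_inl prod_inlM.
HB.instance Definition _ :=
  Multiplicative_isUMagmaMorphism.Build G prod_group prod_inl prod_inl1.
HB.instance Definition _ :=
  isMultiplicative.Build H prod_group prod_inr prod_inrM.
HB.instance Definition _ :=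
  Multiplicative_isUMagmaMorphism.Build H prod_group prod_inr prod_inr1.

Lemma prod_inl_inj : injective prod_inl. Proof. by move=> x y []. Qed.

Lemma prod_inr_inj : injective prod_inr. Proof. by move=> x y []. Qed.

End ProductGroup.

Section ProductMetric.
Context {R : realType} (G H : groupType).
Implicit Types (dG : G -> G -> R) (dH : H -> H -> R).

Definition prod_metric dG dH (x y : prod_group G H) : R :=
  Num.max (dG x.1 y.1) (dH x.2 y.2).

Lemma prod_metric_lt dG dH x y e :
  prod_metric dG dH x y < e <-> dG x.1 y.1 < e /\ dH x.2 y.2 < e.
Proof. by rewrite /prod_metric gt_max; split=> [/andP|[-> ->]]. Qed.

Lemma prod_is_metric dG dH : is_metric dG -> is_metric dH ->
  is_metric (prod_metric dG dH).
Proof.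
move=> mG mH; have [G0 Gxy Gs Gt] := mG; have [H0 Hxy Hs Ht] := mH.
split=> [x y|[x x'] [y y']|x y|x y z]; rewrite /prod_metric /=.
- by rewrite le_max G0.
- split=> [xy|[<- <-]].
    have [x0 y0] : dG x y <= 0 /\ dH x' y' <= 0.
      by rewrite -xy !le_max !lexx orbT.
    by congr pair; [apply/Gxy|apply/Hxy]; apply/eqP;
      rewrite eq_le ?G0 ?H0 andbT.
  by rewrite (metric_refl _ mG) (metric_refl _ mH) maxxx.
- by rewrite Gs Hs.
- rewrite ge_max; apply/andP; split.
    by apply: le_trans (Gt _ _ z.1) _; rewrite lerD ?le_max ?lexx.
  by apply: le_trans (Ht _ _ z.2) _; rewrite lerD ?le_max ?lexx ?orbT.
Qed.

Lemma prod_metric_group dG dH : metric_group dG -> metric_group dH ->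
  metric_group (prod_metric dG dH).
Proof.
move=> [mG GM GV] [mH HM HV]; split; first exact: prod_is_metric.
- move=> x y e e0; have [a a0 aM] := GM x.1 y.1 e e0.
  have [b b0 bM] := HM x.2 y.2 e e0.
  exists (Num.min a b); first by rewrite lt_min a0.
  move=> x' y' /prod_metric_lt[+ +] /prod_metric_lt[].
  rewrite !lt_min => /andP[xa _] /andP[_ xb] /andP[ya _] /andP[_ yb].
  by apply/prod_metric_lt; split; [exact: aM|exact: bM].
- move=> x e e0; have [a a0 aV] := GV x.1 e e0; have [b b0 bV] := HV x.2 e e0.
  exists (Num.min a b); first by rewrite lt_min a0.
  move=> x' /prod_metric_lt[]; rewrite !lt_min => /andP[xa _] /andP[_ xb].
  by apply/prod_metric_lt; split; [exact: aV|exact: bV].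
Qed.

Lemma prod_mcomplete dG dH : mcomplete dG -> mcomplete dH ->
  mcomplete (prod_metric dG dH).
Proof.
move=> GC HC u uC.
have [|x xl] := GC (fun n => (u n).1).
  move=> e /uC[N uN]; exists N => m n mN nN.
  by have /prod_metric_lt[] := uN m n mN nN.
have [|y yl] := HC (fun n => (u n).2).
  move=> e /uC[N uN]; exists N => m n mN nN.
  by have /prod_metric_lt[] := uN m n mN nN.
exists (x, y) => e e0; have [N xN] := xl e e0; have [M yM] := yl e e0.
exists (maxn N M) => n; rewrite geq_max => /andP[/xN ? /yM ?].
exact/prod_metric_lt.
Qed.

Lemma prod_is_ultrametric dG dH : is_ultrametric dG -> is_ultrametric dH ->
  is_ultrametric (prod_metric dG dH).
Proof.
move=> [mG Gt] [mH Ht]; split=> [|x y z]; first exact: prod_is_metric.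
rewrite /prod_metric ge_max; apply/andP; split.
  by apply: le_trans (Gt _ _ z.1) _; rewrite ge_max !le_max !lexx ?orbT.
by apply: le_trans (Ht _ _ z.2) _; rewrite ge_max !le_max !lexx ?orbT.
Qed.

Lemma prod_left_invariant dG dH : left_invariant_metric dG ->
  left_invariant_metric dH -> left_invariant_metric (prod_metric dG dH).
Proof. by move=> Gl Hl f x y; rewrite /prod_metric /= Gl Hl. Qed.

Lemma prod_metric_id dG dH dG' dH' : mcontinuous dG dG' id ->
  mcontinuous dH dH' id ->
  mcontinuous (prod_metric dG dH) (prod_metric dG' dH') id.
Proof.
move=> Gc Hc x e e0; have [a a0 xa] := Gc x.1 e e0; have [b b0 xb] :=
  Hc x.2 e e0.
exists (Num.min a b); first by rewrite lt_min a0.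
move=> y /prod_metric_lt[]; rewrite !lt_min => /andP[ya _] /andP[_ yb].
by apply/prod_metric_lt; split; [exact: xa|exact: xb].
Qed.

Lemma prod_inl_continuous dG dH : is_metric dH ->
  mcontinuous dG (prod_metric dG dH) (@prod_inl G H).
Proof.
move=> mH x e e0; exists e => // y xy; apply/prod_metric_lt.
by rewrite /= (metric_refl _ mH).
Qed.

Lemma prod_inr_continuous dG dH : is_metric dG ->
  mcontinuous dH (prod_metric dG dH) (@prod_inr G H).
Proof.
move=> mG x e e0; exists e => // y xy; apply/prod_metric_lt.
by rewrite /= (metric_refl _ mG).
Qed.

End ProductMetric.

(** * Free products of Polish groups *)

Section Assembly.
Context {R : realType} (G H : topologicalGroupType).
Variables (dG : G -> G -> R) (dH : H -> H -> R).
Hypotheses (dGm : is_metric dG) (dGc : compatible_metric dG)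
  (dGC : complete_metric dG).
Hypotheses (dHm : is_metric dH) (dHc : compatible_metric dH)
  (dHC : complete_metric dH).
Hypotheses (sepG : separable_space G) (sepH : separable_space H).
Variables (delG : G -> G -> R) (delH : H -> H -> R).
Hypotheses (delGl : left_invariant_metric delG)
  (delHl : left_invariant_metric delH).
Hypotheses (GdG : mcontinuous dG delG id) (HdH : mcontinuous dH delH id).
Variables (sigma : R -> R) (nu : 'M[R]_2 -> R) (W : set R).
Hypothesis hnu : coefficient_norm sigma nu W.
Local Notation K := (prod_group G H).
Local Notation dK := (prod_metric dG dH).
Local Notation delK := (prod_metric delG delH).
Local Notation test := (lipschitz_test sigma W delK).
Hypothesis test_cst : exists u w, test u w.
Hypothesis test_sep : forall x y, x != y -> exists u w, test u w /\ u x != u y.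
Hypothesis test_conv : forall u v w w' e,
  test u w -> test v w' -> 0 < e < 1 ->
  exists w'', test (fun x => (1 - e) * u x + e * v x) w''.

(** The complete metrics [dG] and [dH] give the completeness of the ambient
    group, while the left invariant metrics [delG] and [delH] are those for
    which the test functions are Lipschitz. *)
Lemma free_product_polish :
  exists (T : topologicalGroupType)
      (psiG : UMagmaMorphism.type G T) (psiH : UMagmaMorphism.type H T),
    [/\ polish_group R T, topgroup_embedding psiG, topgroup_embedding psiH &
        injective (fp_lift psiG psiH)] /\
    (is_ultrametric delG -> is_ultrametric delH ->
     mcontinuous delG dG id -> mcontinuous delH dH id ->
     (forall a b, nu (a + b) <= Num.max (nu a) (nu b)) ->
     (forall a, nu a <= 1) ->
     left_inv_ultrametrizable R T).
Proof.
have hG := compatible_metric_group dGm dGc.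
have hH := compatible_metric_group dHm dHc.
have hK := prod_metric_group hG hH.
have delKl := prod_left_invariant delGl delHl.
have KdK := prod_metric_id GdG HdH.
pose hN := test_ring_norm hnu test_cst.
pose hA := test_action nu delKl test_cst.
pose f := test_transvection hnu hK delKl KdK test_cst.
(* Conjugating by 1 on one side lets both embeddings have the same form. *)
pose psiG := conj_incl (1%g : semidirect hK hN hA) (@prod_inl G H).
pose psiH := conj_incl f (@prod_inr G H).
have DC := sd_complete (hK := hK) (hN := hN) (hA :=
  hA) (prod_mcomplete (compatible_complete dGc dGC)
  (compatible_complete dHc dHC)) (test_complete hnu test_cst).
have bc := sd_base_continuous (hK := hK) (hN := hN) (hA := hA).
have f1 : sd_base f = 1%g by [].
have psiGc := conj_incl_continuous (1%g : semidirect hK hN hA)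
  (prod_inl_continuous dG dHm).
have psiHc := conj_incl_continuous f (prod_inr_continuous dH dGm).
have rGc : mcontinuous (@sd_dist _ _ dK _ _ _ hK hN hA dK) dG (fun t => (sd_base t).1).
  by move=> t e /(bc t)[c c0 tc]; exists c => // u /tc /prod_metric_lt[].
have rHc : mcontinuous (@sd_dist _ _ dK _ _ _ hK hN hA dK) dH (fun t => (sd_base t).2).
  by move=> t e /(bc t)[c c0 tc]; exists c => // u /tc /prod_metric_lt[].
have psiGK : cancel psiG (fun t => (sd_base t).1).
  by move=> x; rewrite conj_incl_base.
have psiHK : cancel psiH (fun t => (sd_base t).2).
  by move=> x; rewrite conj_incl_base.
have inj : injective (fp_lift psiG psiH).
  apply: lift_semidirect_injective => //;
    [exact: prod_inl_inj|exact: prod_inr_inj|].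
  exact: (test_translates_free hnu hK delKl KdK test_cst test_sep test_conv).
have [T [jG [jH [Tp Tu]]]] := free_product_closure dGc dHc
  (compatible_separable dGc sepG) (compatible_separable dHc sepH)
  (sd_metric_group hK hN hA) DC psiGc psiHc rGc rHc psiGK psiHK inj.
exists T, jG, jH; split=> // Gu Hu dGd dHd nuU nu1.
have [] := @sd_dist_equiv R K dK _ _ _ hK hN hA delK KdK (prod_metric_id dGd dHd).
have [y0 _] := test_point_inhabited test_cst.
have wgt0 (y : test_point sigma W delK) : 0 < test_weight y.
  by have [/(weight_gt0 hnu)] := test_funP y.
move=> Dd dD; apply: (Tu _ Dd dD).
  apply: sd_ultrametric; first exact: prod_is_ultrametric.
  exact: (sup_norm_ultra y0 wgt0 nuU).
apply: sd_left_invariant => //.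
exact: (sup_norm_contract y0 (nu_ge0 hnu) (nuM hnu) wgt0 nu1).
Qed.
End Assembly.

Theorem theorem3p8 (R : realType) (G H : topologicalGroupType)
    (polishG : polish_group R G) (polishH : polish_group R H) :
  (exists (T : topologicalGroupType)
      (psiG : UMagmaMorphism.type G T)
      (psiH : UMagmaMorphism.type H T),
     [/\ polish_group R T,
         topgroup_embedding psiG,
         topgroup_embedding psiH &
         injective (fp_lift psiG psiH)]) /\
  (left_inv_ultrametrizable R G -> left_inv_ultrametrizable R H ->
   exists (T : topologicalGroupType)
      (psiG : UMagmaMorphism.type G T)
      (psiH : UMagmaMorphism.type H T),
     [/\ polish_group R T,
         topgroup_embedding psiG,
         topgroup_embedding psiH,
         injective (fp_lift psiG psiH) &
         left_inv_ultrametrizable R T]).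
Proof.
have [sepG [dG [mG cG CG]]] := polishG.
have [sepH [dH [mH cH CH]]] := polishH.
split.
  have [delG [delGm delGl GdG _]] :=
    left_invariant_metrization (compatible_metric_group mG cG).
  have [delH [delHm delHl HdH _]] :=
    left_invariant_metrization (compatible_metric_group mH cH).
  have delm := prod_is_metric delGm delHm.
  have [T [jG [jH [Tp _]]]] := free_product_polish mG cG CG mH cH CH sepG sepH
    delGl delHl GdG HdH archimedean_coefficient_norm
    (archimedean_test_cst delm) (archimedean_test_sep delm)
    (archimedean_test_conv (del := prod_metric delG delH)).
  by exists T, jG, jH.
move=> [delG [Gu Gc Gl]] [delH [Hu Hc Hl]].
have delu := prod_is_ultrametric Gu Hu.
have compat (X : topologicalType) (d d' : X -> X -> R) :
    compatible_metric d -> compatible_metric d' -> mcontinuous d d' id.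
  move=> dc dc' x e e0.
  by have /dc[c c0 cd] : nbhs x [set y | d' x y < e]; [apply/dc';
    exists e|exists c].
have [T [jG [jH [[T1 T2 T3 T4] Tu]]]] := free_product_polish mG cG CG mH cH CH
  sepG sepH Gl Hl (compat _ _ _ cG Gc) (compat _ _ _ cH Hc)
  discrete_coefficient_norm (discrete_test_cst delu) (discrete_test_sep delu)
  (discrete_test_conv delu).
exists T, jG, jH; split=> //; apply: Tu => //.
- exact: compat.
- exact: compat.
- exact: discrete_norm_ultra.
- exact: discrete_norm_le1.
Qed.
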